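(* Let $\mathbb K$ be a field, let $\Gamma$ be a row-finite $\ell$-graph with no sources, and let $f:\mathbb N^k\to\mathbb N^\ell$ be a surjective monoid homomorphism with group completion $\bar f:\mathbb Z^k\to\mathbb Z^\ell$. Put $H=\ker\bar f$ and $B=\mathrm{KP}_{\mathbb K}(\Gamma)$. For every group homomorphism $j:\mathbb Z^\ell\to\mathbb Z^k$ with $\bar f\circ j=\mathrm{id}$, there is a $\mathbb Z^k$-graded isomorphism of $\mathbb K$-algebras $$\Theta_j:\mathrm{KP}_{\mathbb K}(f^*\Gamma)\longrightarrow B\otimes_{\mathbb K}\mathbb K[H]$$ determined by $$\Theta_j(p_v)=p_v\otimes 1,\qquad \Theta_j(s_{(\lambda,n)})=s_\lambda\otimes u_{n-j(d(\lambda))},\qquad \Theta_j(s_{(\lambda,n)^*})=s_{\lambda^*}\otimes u_{j(d(\lambda))-n}$$ for $v\in\Gamma^0$ and $(\lambda,n)\in f^*\Gamma$. Here the source carries its canonical $\mathbb Z^k$-grading and the target carries the $\mathbb Z^k$-grading $\bigoplus_{g\in\mathbb Z^k}D_g$ with $D_g=B_{\bar f(g)}\otimes_{\mathbb K}\mathbb K\,u_{g-j(\bar f(g))}$.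
   Context: $\mathbb N$ contains $0$. A $k$-graph is a countable small category $\Lambda$ with a functor $d:\Lambda\to\mathbb N^k$ satisfying the factorisation property: if $d(\lambda)=m+n$ there are unique composable $\mu,\nu$ with $\lambda=\mu\nu$, $d(\mu)=m$, $d(\nu)=n$. Objects are identified with $\Lambda^0=d^{-1}(0)$ (vertices); $r,s$ are range and source, and $\mu\nu$ is defined when $s(\mu)=r(\nu)$. Put $v\Lambda^n=\{\lambda: d(\lambda)=n,\ r(\lambda)=v\}$. $\Lambda$ is row-finite if every $v\Lambda^n$ is finite, and has no sources if every $v\Lambda^n$ is nonempty. For a commutative unital ring $R$ and a row-finite $k$-graph $\Lambda$ with no sources, $\mathrm{KP}_R(\Lambda)$ is the universal $R$-algebra (nonunital in general) generated by $\{p_v:v\in\Lambda^0\}\cup\{s_\lambda,s_{\lambda^*}:\lambda\in\Lambda\setminus\Lambda^0\}$, with $s_v=s_{v^*}=p_v$, subject to: (KP1) the $p_v$ are mutually orthogonal idempotents; (KP2) $s_\lambda s_\mu=s_{\lambda\mu}$ and $s_{\mu^*}s_{\lambda^*}=s_{(\lambda\mu)^*}$ whenever $\lambda\mu$ is defined, and $p_{r(\lambda)}s_\lambda=s_\lambda=s_\lambda p_{s(\lambda)}$, $p_{s(\lambda)}s_{\lambda^*}=s_{\lambda^*}=s_{\lambda^*}p_{r(\lambda)}$; (KP3) if $d(\lambda)=d(\mu)$ then $s_{\lambda^*}s_\mu=\delta_{\lambda,\mu}p_{s(\lambda)}$; (KP4) $p_v=\sum_{\lambda\in v\Lambda^n}s_\lambda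 s_{\lambda^*}$ for $v\in\Lambda^0$, $0\ne n\in\mathbb N^k$. Its canonical $\mathbb Z^k$-grading has $\deg(s_\lambda s_{\mu^*})=d(\lambda)-d(\mu)$; for $B=\mathrm{KP}_{\mathbb K}(\Gamma)$ write $B=\bigoplus_{q\in\mathbb Z^\ell}B_q$. The pullback is $f^*\Gamma=\{(\lambda,n)\in\Gamma\times\mathbb N^k:d(\lambda)=f(n)\}$, a $k$-graph with degree $d(\lambda,n)=n$ and product $(\lambda,n)(\mu,m)=(\lambda\mu,n+m)$; its vertices $(v,0)$ are identified with $v\in\Gamma^0$. It is row-finite with no sources when $\Gamma$ is. $\mathbb K[H]$ is the group algebra with basis $\{u_h:h\in H\}$, $u_hu_g=u_{h+g}$. The section $j$ need not map $\mathbb N^\ell$ into $\mathbb N^k$. *)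

(* Defs.v *)
From HB Require Import structures.
From mathcomp Require Import all_boot all_order all_algebra finmap.
From mathcomp Require Import generic_quotient boolp monalg.

Set Implicit Arguments.
Unset Strict Implicit.
Unset Printing Implicit Defensive.

Import GRing.Theory.
Local Open Scope quotient_scope.
Local Open Scope ring_scope.

HB.mixin Record Lmodule_isNUAlgebra (R : pzRingType) A of GRing.Lmodule R A := {
  numul : A -> A -> A;
  numulA : associative numul;
  numulDl : left_distributive numul +%R;
  numulDr : right_distributive numul +%R;
  numulZl : forall (a : R) (x y : A), numul (a *: x) y = a *: numul x y;
  numulZr : forall (a : R) (x y : A), numul x (a *: y) = a *: numul x y
}.

#[short(type="nuAlgType")]
HB.structure Definition NUAlgebra (R : pzRingType) :=
  {A of GRing.Lmodule R A & Lmodule_isNUAlgebra R A}.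

Notation "x ** y" := (numul x y) (at level 40, left associativity) : ring_scope.

(* The axioms of a left module up to the congruence pm_eq; pm_quot below is the
   quotient module. *)
Record premod (R : pzRingType) := Premod {
  pm_car : Type;
  pm_eq : pm_car -> pm_car -> Prop;
  pm_zero : pm_car;
  pm_opp : pm_car -> pm_car;
  pm_add : pm_car -> pm_car -> pm_car;
  pm_scale : R -> pm_car -> pm_car;
  pm_refl : forall x, pm_eq x x;
  pm_sym : forall x y, pm_eq x y -> pm_eq y x;
  pm_trans : forall x y z, pm_eq x y -> pm_eq y z -> pm_eq x z;
  pm_oppC : forall x x', pm_eq x x' -> pm_eq (pm_opp x) (pm_opp x');
  pm_addC : forall x x' y y', pm_eq x x' -> pm_eq y y' ->
    pm_eq (pm_add x y) (pm_add x' y');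
  pm_scaleC : forall a x x', pm_eq x x' -> pm_eq (pm_scale a x) (pm_scale a x');
  pm_addrA : forall x y z,
    pm_eq (pm_add x (pm_add y z)) (pm_add (pm_add x y) z);
  pm_addrC : forall x y, pm_eq (pm_add x y) (pm_add y x);
  pm_add0r : forall x, pm_eq (pm_add pm_zero x) x;
  pm_addNr : forall x, pm_eq (pm_add (pm_opp x) x) pm_zero;
  pm_scalerA : forall a b x,
    pm_eq (pm_scale a (pm_scale b x)) (pm_scale (a * b) x);
  pm_scale1r : forall x, pm_eq (pm_scale 1 x) x;
  pm_scalerDr : forall a x y,
    pm_eq (pm_scale a (pm_add x y)) (pm_add (pm_scale a x) (pm_scale a y));
  pm_scalerDl : forall x a b,
    pm_eq (pm_scale (a + b) x) (pm_add (pm_scale a x) (pm_scale b x))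
}.

Section PremodQuotient.
Variables (R : pzRingType) (P : premod R).

Definition pm_eqb (x y : {classic pm_car P}) : bool := `[< pm_eq x y >].

Lemma pm_eqb_refl : reflexive pm_eqb.
Proof. by move=> x; apply/asboolP; apply: pm_refl. Qed.
Lemma pm_eqb_sym : symmetric pm_eqb.
Proof. by move=> x y; apply/asboolP/asboolP; apply: pm_sym. Qed.
Lemma pm_eqb_trans : transitive pm_eqb.
Proof. by move=> y x z /asboolP xy /asboolP /(pm_trans xy) xz; apply/asboolP. Qed.

Canonical pm_equiv := EquivRel pm_eqb pm_eqb_refl pm_eqb_sym pm_eqb_trans.

Definition pm_quot := {eq_quot pm_equiv}.

HB.instance Definition _ := Choice.on pm_quot.
Definition pm_pi (x : pm_car P) : pm_quot := \pi_pm_quot (x : {classic pm_car P}).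
Definition pm_repr (q : pm_quot) : pm_car P := repr q.

Lemma pm_reprK q : pm_pi (pm_repr q) = q.
Proof. exact: reprK. Qed.
Lemma pm_piP x y : pm_pi x = pm_pi y <-> pm_eq x y.
Proof.
split=> [/eqquotP /asboolP // | e]; apply/eqquotP; exact/asboolP.
Qed.
Lemma pm_repr_pi x : pm_eq (pm_repr (pm_pi x)) x.
Proof. by apply/pm_piP; rewrite pm_reprK. Qed.

Definition pmq_add (x y : pm_quot) := pm_pi (pm_add (pm_repr x) (pm_repr y)).
Definition pmq_opp (x : pm_quot) := pm_pi (pm_opp (pm_repr x)).
Definition pmq_scale (a : R) (x : pm_quot) := pm_pi (pm_scale a (pm_repr x)).

Lemma pmq_addE x y : pmq_add (pm_pi x) (pm_pi y) = pm_pi (pm_add x y).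
Proof. by apply/pm_piP; apply: pm_addC; apply: pm_repr_pi. Qed.
Lemma pmq_oppE x : pmq_opp (pm_pi x) = pm_pi (pm_opp x).
Proof. by apply/pm_piP; apply: pm_oppC; apply: pm_repr_pi. Qed.
Lemma pmq_scaleE a x : pmq_scale a (pm_pi x) = pm_pi (pm_scale a x).
Proof. by apply/pm_piP; apply: pm_scaleC; apply: pm_repr_pi. Qed.

Lemma pm_ind (Q : pm_quot -> Prop) : (forall x, Q (pm_pi x)) -> forall q, Q q.
Proof. by move=> h q; rewrite -(pm_reprK q). Qed.

Fact pmq_addA : associative pmq_add.
Proof.
elim/pm_ind=> x; elim/pm_ind=> y; elim/pm_ind=> z.
by rewrite !pmq_addE; apply/pm_piP/pm_addrA.
Qed.
Fact pmq_addC : commutative pmq_add.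
Proof.
elim/pm_ind=> x; elim/pm_ind=> y.
by rewrite !pmq_addE; apply/pm_piP/pm_addrC.
Qed.
Fact pmq_add0 : left_id (pm_pi (pm_zero P)) pmq_add.
Proof. by elim/pm_ind=> x; rewrite pmq_addE; apply/pm_piP/pm_add0r. Qed.
Fact pmq_addN : left_inverse (pm_pi (pm_zero P)) pmq_opp pmq_add.
Proof.
by elim/pm_ind=> x; rewrite pmq_oppE pmq_addE; apply/pm_piP/pm_addNr.
Qed.
HB.instance Definition _ :=
  GRing.isZmodule.Build pm_quot pmq_addA pmq_addC pmq_add0 pmq_addN.

Fact pmq_scaleA a b x : pmq_scale a (pmq_scale b x) = pmq_scale (a * b) x.
Proof.
by elim/pm_ind: x => x; rewrite !pmq_scaleE; apply/pm_piP/pm_scalerA.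
Qed.
Fact pmq_scale1 : left_id 1 pmq_scale.
Proof. by elim/pm_ind=> x; rewrite !pmq_scaleE; apply/pm_piP/pm_scale1r. Qed.
Fact pmq_scaleDr : right_distributive pmq_scale +%R.
Proof.
move=> a; elim/pm_ind=> x; elim/pm_ind=> y.
by rewrite /GRing.add /= !(pmq_addE, pmq_scaleE); apply/pm_piP/pm_scalerDr.
Qed.
Fact pmq_scaleDl x : {morph pmq_scale^~ x : a b / a + b}.
Proof.
move=> a b; elim/pm_ind: x => x.
by rewrite [RHS]/GRing.add /= !(pmq_addE, pmq_scaleE); apply/pm_piP/pm_scalerDl.
Qed.
HB.instance Definition _ := GRing.Zmodule_isLmodule.Build R pm_quot
  pmq_scaleA pmq_scale1 pmq_scaleDr pmq_scaleDl.

Lemma pm_piD x y : pm_pi (pm_add x y) = pm_pi x + pm_pi y.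
Proof. by rewrite -pmq_addE. Qed.
Lemma pm_piZ a x : pm_pi (pm_scale a x) = a *: pm_pi x.
Proof. by rewrite -pmq_scaleE. Qed.
Lemma pm_piN x : pm_pi (pm_opp x) = - pm_pi x.
Proof. by rewrite -pmq_oppE. Qed.
Lemma pm_pi0 : pm_pi (pm_zero P) = 0.
Proof. by []. Qed.

End PremodQuotient.

Section Presentation.
Variables (R : comPzRingType) (X : Type).

Inductive aterm : Type :=
| TGen of X
| TZero
| TOpp of aterm
| TAdd of aterm & aterm
| TScale of R & aterm
| TMul of aterm & aterm.

Variable rel : aterm -> aterm -> Prop.

Inductive acong : aterm -> aterm -> Prop :=
| acong_rel x y : rel x y -> acong x y
| acong_refl x : acong x x
| acong_sym x y : acong x y -> acong y x
| acong_trans x y z : acong x y -> acong y z -> acong x z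
| acong_opp x x' : acong x x' -> acong (TOpp x) (TOpp x')
| acong_add x x' y y' :
    acong x x' -> acong y y' -> acong (TAdd x y) (TAdd x' y')
| acong_scale a x x' : acong x x' -> acong (TScale a x) (TScale a x')
| acong_mul x x' y y' :
    acong x x' -> acong y y' -> acong (TMul x y) (TMul x' y')
| acong_addrA x y z : acong (TAdd x (TAdd y z)) (TAdd (TAdd x y) z)
| acong_addrC x y : acong (TAdd x y) (TAdd y x)
| acong_add0r x : acong (TAdd TZero x) x
| acong_addNr x : acong (TAdd (TOpp x) x) TZero
| acong_scalerA a b x : acong (TScale a (TScale b x)) (TScale (a * b) x)
| acong_scale1r x : acong (TScale 1 x) x
| acong_scalerDr a x y :
    acong (TScale a (TAdd x y)) (TAdd (TScale a x) (TScale a y))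
| acong_scalerDl x a b :
    acong (TScale (a + b) x) (TAdd (TScale a x) (TScale b x))
| acong_mulA x y z : acong (TMul x (TMul y z)) (TMul (TMul x y) z)
| acong_mulDl x y z : acong (TMul (TAdd x y) z) (TAdd (TMul x z) (TMul y z))
| acong_mulDr x y z : acong (TMul x (TAdd y z)) (TAdd (TMul x y) (TMul x z))
| acong_mulZl a x y : acong (TMul (TScale a x) y) (TScale a (TMul x y))
| acong_mulZr a x y : acong (TMul x (TScale a y)) (TScale a (TMul x y)).

Definition pres_premod : premod R := {|
  pm_refl := acong_refl; pm_sym := acong_sym; pm_trans := acong_trans;
  pm_oppC := acong_opp; pm_addC := acong_add; pm_scaleC := acong_scale;
  pm_addrA := acong_addrA; pm_addrC := acong_addrC; pm_add0r := acong_add0r;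
  pm_addNr := acong_addNr; pm_scalerA := acong_scalerA;
  pm_scale1r := acong_scale1r; pm_scalerDr := acong_scalerDr;
  pm_scalerDl := acong_scalerDl |}.

(* The universal nonunital R-algebra on generators X subject to rel: see
   pres_universal. *)
Definition pres_alg := pm_quot pres_premod.
HB.instance Definition _ := GRing.Lmodule.on pres_alg.

Definition pres_pi (t : aterm) : pres_alg := @pm_pi R pres_premod t.

Lemma pres_piP s t : pres_pi s = pres_pi t <-> acong s t.
Proof. exact: (@pm_piP R pres_premod). Qed.

Lemma pres_ind (Q : pres_alg -> Prop) :
  (forall t, Q (pres_pi t)) -> forall x, Q x.
Proof. exact: (@pm_ind R pres_premod). Qed.

Definition pres_mul (x y : pres_alg) : pres_alg :=
  pres_pi (TMul (@pm_repr R pres_premod x) (@pm_repr R pres_premod y)).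

Lemma pres_mulE s t : pres_mul (pres_pi s) (pres_pi t) = pres_pi (TMul s t).
Proof. by apply/pres_piP; apply: acong_mul; apply: (@pm_repr_pi R pres_premod). Qed.
Lemma pres_piD s t : pres_pi (TAdd s t) = pres_pi s + pres_pi t.
Proof. exact: (@pm_piD R pres_premod). Qed.
Lemma pres_piZ a t : pres_pi (TScale a t) = a *: pres_pi t.
Proof. exact: (@pm_piZ R pres_premod). Qed.
Lemma pres_piN t : pres_pi (TOpp t) = - pres_pi t.
Proof. exact: (@pm_piN R pres_premod). Qed.
Lemma pres_pi0 : pres_pi TZero = 0.
Proof. by []. Qed.

Fact pres_mulA : associative pres_mul.
Proof.
elim/pres_ind=> x; elim/pres_ind=> y; elim/pres_ind=> z.
by rewrite !pres_mulE; apply/pres_piP/acong_mulA.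
Qed.
Fact pres_mulDl : left_distributive pres_mul +%R.
Proof.
elim/pres_ind=> x; elim/pres_ind=> y; elim/pres_ind=> z.
by rewrite -pres_piD !pres_mulE -pres_piD; apply/pres_piP/acong_mulDl.
Qed.
Fact pres_mulDr : right_distributive pres_mul +%R.
Proof.
elim/pres_ind=> x; elim/pres_ind=> y; elim/pres_ind=> z.
by rewrite -pres_piD !pres_mulE -pres_piD; apply/pres_piP/acong_mulDr.
Qed.
Fact pres_mulZl a x y : pres_mul (a *: x) y = a *: pres_mul x y.
Proof.
elim/pres_ind: x => x; elim/pres_ind: y => y.
by rewrite -pres_piZ !pres_mulE -pres_piZ; apply/pres_piP/acong_mulZl.
Qed.
Fact pres_mulZr a x y : pres_mul x (a *: y) = a *: pres_mul x y.
Proof.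
elim/pres_ind: x => x; elim/pres_ind: y => y.
by rewrite -pres_piZ !pres_mulE -pres_piZ; apply/pres_piP/acong_mulZr.
Qed.
HB.instance Definition _ := Lmodule_isNUAlgebra.Build R pres_alg
  pres_mulA pres_mulDl pres_mulDr pres_mulZl pres_mulZr.

Lemma pres_piM s t : pres_pi (TMul s t) = pres_pi s ** pres_pi t.
Proof. by rewrite -pres_mulE. Qed.

Definition pres_gen (x : X) : pres_alg := pres_pi (TGen x).

Fixpoint term_eval (A : nuAlgType R) (phi : X -> A) (t : aterm) : A :=
  match t with
  | TGen x => phi x
  | TZero => 0
  | TOpp s => - term_eval phi s
  | TAdd s u => term_eval phi s + term_eval phi u
  | TScale a s => a *: term_eval phi s
  | TMul s u => term_eval phi s ** term_eval phi u
  end.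

Lemma pres_universal (A : nuAlgType R) (phi : X -> A) :
  (forall s t, rel s t -> term_eval phi s = term_eval phi t) ->
  exists F : {linear pres_alg -> A},
    [/\ {morph F : x y / x ** y}, forall x, F (pres_gen x) = phi x &
        forall G : {linear pres_alg -> A}, {morph G : x y / x ** y} ->
          (forall x, G (pres_gen x) = phi x) -> G =1 F].
Proof.
move=> relP.
have evC s t : acong s t -> term_eval phi s = term_eval phi t.
  elim=> {s t} //=; first by move=> x y z _ -> _ ->.
  - by move=> x x' _ ->.
  - by move=> x x' y y' _ -> _ ->.
  - by move=> a x x' _ ->.
  - by move=> x x' y y' _ -> _ ->.
  - by move=> x y z; rewrite addrA.
  - by move=> x y; rewrite addrC.
  - by move=> x; rewrite add0r.
  - by move=> x; rewrite addNr.
  - by move=> a b x; rewrite scalerA.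
  - by move=> x; rewrite scale1r.
  - by move=> a x y; rewrite scalerDr.
  - by move=> x a b; rewrite scalerDl.
  - by move=> x y z; rewrite numulA.
  - by move=> x y z; rewrite numulDl.
  - by move=> x y z; rewrite numulDr.
  - by move=> a x y; rewrite numulZl.
  - by move=> a x y; rewrite numulZr.
pose F0 (x : pres_alg) := term_eval phi (@pm_repr R pres_premod x).
have F0E t : F0 (pres_pi t) = term_eval phi t.
  by apply/evC/(@pm_repr_pi R pres_premod).
have F0lin : linear F0.
  move=> a; elim/pres_ind=> x; elim/pres_ind=> y.
  by rewrite -pres_piZ -pres_piD !F0E.
pose FL := GRing.isLinear.Build R pres_alg A _ F0 F0lin.
pose F : {linear pres_alg -> A} := HB.pack F0 FL.
have FE t : F (pres_pi t) = term_eval phi t by exact: F0E.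
exists F; split => [|x|G Gm Gg].
- elim/pres_ind=> x; elim/pres_ind=> y.
  by rewrite -pres_piM !FE.
- by rewrite FE.
- elim/pres_ind=> t; rewrite FE; elim: t => /= [x|||||].
  + by rewrite -Gg.
  + by rewrite pres_pi0 linear0.
  + by move=> t IH; rewrite pres_piN linearN IH.
  + by move=> s IHs t IHt; rewrite pres_piD linearD IHs IHt.
  + by move=> a t IH; rewrite pres_piZ linearZ IH.
  + by move=> s IHs t IHt; rewrite pres_piM Gm IHs IHt.
Qed.

End Presentation.
Arguments TZero {R X}.

Section Tensor.
Variables (R : comPzRingType) (A B : lmodType R).

Inductive tterm : Type :=
| ETens of A & B
| EZero
| EOpp of tterm
| EAdd of tterm & tterm
| EScale of R & tterm.

Inductive tcong : tterm -> tterm -> Prop :=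
| tcong_tensDl x x' y :
    tcong (ETens (x + x') y) (EAdd (ETens x y) (ETens x' y))
| tcong_tensDr x y y' :
    tcong (ETens x (y + y')) (EAdd (ETens x y) (ETens x y'))
| tcong_tensZl a x y : tcong (ETens (a *: x) y) (EScale a (ETens x y))
| tcong_tensZr a x y : tcong (ETens x (a *: y)) (EScale a (ETens x y))
| tcong_refl x : tcong x x
| tcong_sym x y : tcong x y -> tcong y x
| tcong_trans x y z : tcong x y -> tcong y z -> tcong x z
| tcong_opp x x' : tcong x x' -> tcong (EOpp x) (EOpp x')
| tcong_add x x' y y' :
    tcong x x' -> tcong y y' -> tcong (EAdd x y) (EAdd x' y')
| tcong_scale a x x' : tcong x x' -> tcong (EScale a x) (EScale a x')
| tcong_addrA x y z : tcong (EAdd x (EAdd y z)) (EAdd (EAdd x y) z)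
| tcong_addrC x y : tcong (EAdd x y) (EAdd y x)
| tcong_add0r x : tcong (EAdd EZero x) x
| tcong_addNr x : tcong (EAdd (EOpp x) x) EZero
| tcong_scalerA a b x : tcong (EScale a (EScale b x)) (EScale (a * b) x)
| tcong_scale1r x : tcong (EScale 1 x) x
| tcong_scalerDr a x y :
    tcong (EScale a (EAdd x y)) (EAdd (EScale a x) (EScale a y))
| tcong_scalerDl x a b :
    tcong (EScale (a + b) x) (EAdd (EScale a x) (EScale b x)).

Definition tens_premod : premod R := {|
  pm_refl := tcong_refl; pm_sym := tcong_sym; pm_trans := tcong_trans;
  pm_oppC := tcong_opp; pm_addC := tcong_add; pm_scaleC := tcong_scale;
  pm_addrA := tcong_addrA; pm_addrC := tcong_addrC; pm_add0r := tcong_add0r;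
  pm_addNr := tcong_addNr; pm_scalerA := tcong_scalerA;
  pm_scale1r := tcong_scale1r; pm_scalerDr := tcong_scalerDr;
  pm_scalerDl := tcong_scalerDl |}.

Definition tensor := pm_quot tens_premod.
HB.instance Definition _ := GRing.Lmodule.on tensor.

Definition tens_pi (t : tterm) : tensor := @pm_pi R tens_premod t.
Definition tens (x : A) (y : B) : tensor := tens_pi (ETens x y).

Lemma tens_piP s t : tens_pi s = tens_pi t <-> tcong s t.
Proof. exact: (@pm_piP R tens_premod). Qed.
Lemma tens_pi_ind (Q : tensor -> Prop) :
  (forall t, Q (tens_pi t)) -> forall x, Q x.
Proof. exact: (@pm_ind R tens_premod). Qed.
Lemma tens_piD s t : tens_pi (EAdd s t) = tens_pi s + tens_pi t.
Proof. exact: (@pm_piD R tens_premod). Qed.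
Lemma tens_piZ a t : tens_pi (EScale a t) = a *: tens_pi t.
Proof. exact: (@pm_piZ R tens_premod). Qed.
Lemma tens_piN t : tens_pi (EOpp t) = - tens_pi t.
Proof. exact: (@pm_piN R tens_premod). Qed.
Lemma tens_pi0 : tens_pi EZero = 0.
Proof. by []. Qed.

Lemma tensDl x x' y : tens (x + x') y = tens x y + tens x' y.
Proof. by rewrite -tens_piD; apply/tens_piP/tcong_tensDl. Qed.
Lemma tensDr x y y' : tens x (y + y') = tens x y + tens x y'.
Proof. by rewrite -tens_piD; apply/tens_piP/tcong_tensDr. Qed.
Lemma tensZl a x y : tens (a *: x) y = a *: tens x y.
Proof. by rewrite -tens_piZ; apply/tens_piP/tcong_tensZl. Qed.
Lemma tensZr a x y : tens x (a *: y) = a *: tens x y.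
Proof. by rewrite -tens_piZ; apply/tens_piP/tcong_tensZr. Qed.

Lemma tens_ind (Q : tensor -> Prop) :
    (forall x y, Q (tens x y)) -> Q 0 -> (forall u v, Q u -> Q v -> Q (u + v)) ->
    (forall a u, Q u -> Q (a *: u)) ->
  forall u, Q u.
Proof.
move=> Qt Q0 QD QZ; elim/tens_pi_ind; elim=> //.
- by move=> t IH; rewrite tens_piN -scaleN1r; apply: QZ.
- by move=> s IHs t IHt; rewrite tens_piD; apply: QD.
- by move=> a t IH; rewrite tens_piZ; apply: QZ.
Qed.

Section Lift.
Variables (W : lmodType R) (b : A -> B -> W).
Hypothesis bDl : forall x x' y, b (x + x') y = b x y + b x' y.
Hypothesis bDr : forall x y y', b x (y + y') = b x y + b x y'.
Hypothesis bZl : forall a x y, b (a *: x) y = a *: b x y.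
Hypothesis bZr : forall a x y, b x (a *: y) = a *: b x y.

Fixpoint tterm_eval (t : tterm) : W :=
  match t with
  | ETens x y => b x y
  | EZero => 0
  | EOpp s => - tterm_eval s
  | EAdd s u => tterm_eval s + tterm_eval u
  | EScale a s => a *: tterm_eval s
  end.

Definition tens_lift (u : tensor) : W := tterm_eval (@pm_repr R tens_premod u).

Lemma tens_liftE t : tens_lift (tens_pi t) = tterm_eval t.
Proof.
have evC s s' : tcong s s' -> tterm_eval s = tterm_eval s'; last first.
  by apply/evC/(@pm_repr_pi R tens_premod).
elim=> {s s' t} //=; first by move=> x y z _ -> _ ->.
- by move=> x x' _ ->.
- by move=> x x' y y' _ -> _ ->.
- by move=> a x x' _ ->.
- by move=> x y z; rewrite addrA.
- by move=> x y; rewrite addrC.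
- by move=> x; rewrite add0r.
- by move=> x; rewrite addNr.
- by move=> c d x; rewrite scalerA.
- by move=> x; rewrite scale1r.
- by move=> a x y; rewrite scalerDr.
- by move=> x c d; rewrite scalerDl.
Qed.

Lemma tens_lift_tens x y : tens_lift (tens x y) = b x y.
Proof. exact: tens_liftE. Qed.

Lemma tens_lift_linear : linear tens_lift.
Proof.
move=> a; elim/tens_pi_ind=> x; elim/tens_pi_ind=> y.
by rewrite -tens_piZ -tens_piD !tens_liftE.
Qed.

End Lift.
End Tensor.

Notation "x \ox y" := (tens x y) (at level 40, left associativity) : ring_scope.

Section TensorAlgebra.
Variables (R : comPzRingType) (A B : nuAlgType R).
Local Notation T := (tensor A B).

Definition tens_mull (x : A) (y : B) : T -> T :=
  tens_lift (fun x' y' => (x ** x') \ox (y ** y')).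
Definition tens_mul (u v : T) : T :=
  tens_lift (fun x y => tens_mull x y v) u.

Lemma tens_mull_tens x y x' y' :
  tens_mull x y (x' \ox y') = (x ** x') \ox (y ** y').
Proof.
apply: (@tens_lift_tens _ _ _ _ (fun x' y' => (x ** x') \ox (y ** y'))) => *;
by rewrite ?(numulDl, numulDr, numulZl, numulZr, tensDl, tensDr, tensZl, tensZr).
Qed.
Lemma tens_mull_linear x y : linear (tens_mull x y).
Proof.
apply: tens_lift_linear => *;
by rewrite ?(numulDl, numulDr, numulZl, numulZr, tensDl, tensDr, tensZl, tensZr).
Qed.
HB.instance Definition _ x y :=
  GRing.isLinear.Build R T T _ (tens_mull x y) (tens_mull_linear x y).

Let mullDl v x x' y : tens_mull (x + x') y v = tens_mull x y v + tens_mull x' y v.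
Proof.
elim/tens_ind: v => [p q||u v IHu IHv|a u IH].
- by rewrite !tens_mull_tens numulDl tensDl.
- by rewrite !linear0 ?addr0.
- by rewrite !linearD /= IHu IHv addrACA.
- by rewrite !linearZ /= IH scalerDr.
Qed.
Let mullDr v x y y' : tens_mull x (y + y') v = tens_mull x y v + tens_mull x y' v.
Proof.
elim/tens_ind: v => [p q||u v IHu IHv|a u IH].
- by rewrite !tens_mull_tens numulDl tensDr.
- by rewrite !linear0 ?addr0.
- by rewrite !linearD /= IHu IHv addrACA.
- by rewrite !linearZ /= IH scalerDr.
Qed.
Let mullZl v a x y : tens_mull (a *: x) y v = a *: tens_mull x y v.
Proof.
elim/tens_ind: v => [p q||u v IHu IHv|c u IH].
- by rewrite !tens_mull_tens numulZl tensZl.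
- by rewrite !linear0 ?scaler0.
- by rewrite !linearD /= IHu IHv.
- by rewrite !linearZ /= IH !scalerA mulrC.
Qed.
Let mullZr v a x y : tens_mull x (a *: y) v = a *: tens_mull x y v.
Proof.
elim/tens_ind: v => [p q||u v IHu IHv|c u IH].
- by rewrite !tens_mull_tens numulZl tensZr.
- by rewrite !linear0 ?scaler0.
- by rewrite !linearD /= IHu IHv.
- by rewrite !linearZ /= IH !scalerA mulrC.
Qed.

Let mulEl x y v : tens_mul (x \ox y) v = tens_mull x y v.
Proof. exact: (tens_lift_tens (mullDl v) (mullDr v) (mullZl v) (mullZr v)). Qed.
Let mulL v : linear (tens_mul^~ v).
Proof. exact: (tens_lift_linear (mullDl v) (mullDr v) (mullZl v) (mullZr v)). Qed.

Lemma tens_mulE x y x' y' :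
  tens_mul (x \ox y) (x' \ox y') = (x ** x') \ox (y ** y').
Proof. by rewrite mulEl tens_mull_tens. Qed.

Fact tens_mulDl : left_distributive tens_mul +%R.
Proof. by move=> u v w; have := mulL w 1 u v; rewrite !scale1r. Qed.
Let tens_mul0l v : tens_mul 0 v = 0.
Proof.
by apply: (addrI (tens_mul 0 v)); rewrite -tens_mulDl !addr0. Qed.
Fact tens_mulZl a u v : tens_mul (a *: u) v = a *: tens_mul u v.
Proof. by have := mulL v a u 0; rewrite tens_mul0l !addr0. Qed.
Fact tens_mulDr : right_distributive tens_mul +%R.
Proof.
move=> u v w; elim/tens_ind: u => [x y||u u' IH IH'|a u IH].
- by rewrite !mulEl linearD.
- by rewrite !tens_mul0l addr0.
- by rewrite !tens_mulDl IH IH' addrACA.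
- by rewrite !tens_mulZl IH scalerDr.
Qed.
Fact tens_mulZr a u v : tens_mul u (a *: v) = a *: tens_mul u v.
Proof.
elim/tens_ind: u => [x y||u u' IH IH'|c u IH].
- by rewrite !mulEl linearZ.
- by rewrite !tens_mul0l scaler0.
- by rewrite !tens_mulDl IH IH' scalerDr.
- by rewrite !tens_mulZl IH !scalerA mulrC.
Qed.
Let tens_mulr0 u : tens_mul u 0 = 0.
Proof. by have := tens_mulZr 0 u 0; rewrite !scale0r. Qed.
Fact tens_mulA : associative tens_mul.
Proof.
move=> u v w; elim/tens_ind: u => [x y||u u' IH IH'|a u IH];
  [|by rewrite !tens_mul0l|by rewrite !tens_mulDl IH IH'|by rewrite !tens_mulZl IH].
elim/tens_ind: v => [x' y'||v v' IH IH'|a v IH];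
  [|by rewrite !(tens_mul0l, tens_mulr0)
   |by rewrite !(tens_mulDl, tens_mulDr) IH IH'
   |by rewrite !(tens_mulZl, tens_mulZr) IH].
elim/tens_ind: w => [x'' y''||v v' IH IH'|a v IH];
  [|by rewrite !tens_mulr0
   |by rewrite !tens_mulDr IH IH'
   |by rewrite !tens_mulZr IH].
by rewrite !tens_mulE !numulA.
Qed.

HB.instance Definition _ := Lmodule_isNUAlgebra.Build R T
  tens_mulA tens_mulDl tens_mulDr tens_mulZl tens_mulZr.

Lemma tensM x y x' y' :
  (x \ox y) ** (x' \ox y') = (x ** x') \ox (y ** y').
Proof. exact: tens_mulE. Qed.

End TensorAlgebra.

(* The library makes malg R H a ring only when H is a monoid without nontrivial
   units, so that the convolution product is defined here for groups. *)

Section GroupAlgebra.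
Variables (R : comNzRingType) (H : zmodType).

Definition galg := {malg R[H]}.
HB.instance Definition _ := GRing.Lmodule.on galg.
Implicit Types (g : galg) (h : H).

Definition gu h : galg := << 1 *g h >>.

Definition galg_mul (g1 g2 : galg) : galg :=
  \sum_(h1 <- msupp g1) \sum_(h2 <- msupp g2) << g1@_h1 * g2@_h2 *g h1 + h2 >>.

Local Open Scope fset_scope.
Local Open Scope ring_scope.

Let mulw (d1 d2 : {fset H}) g1 g2 : msupp g1 `<=` d1 -> msupp g2 `<=` d2 ->
  galg_mul g1 g2 =
    \sum_(h1 <- d1) \sum_(h2 <- d2) << g1@_h1 * g2@_h2 *g h1 + h2 >>.
Proof.
move=> le_d1 le_d2; rewrite /galg_mul (big_fset_incl _ le_d1) /=.
  apply/eq_bigr=> k1 _; apply/big_fset_incl => // k _ /mcoeff_outdom ->.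
  by rewrite mulr0 monalgU0.
move=> k _ /mcoeff_outdom g1k.
by rewrite big1 => // k' _; rewrite g1k mul0r monalgU0.
Qed.

Fact galg_mulC : commutative galg_mul.
Proof.
move=> g1 g2; rewrite /galg_mul exchange_big /=.
by apply: eq_bigr => h1 _; apply: eq_bigr => h2 _; rewrite mulrC addrC.
Qed.

Lemma galg_mulUU c1 c2 h1 h2 :
  galg_mul << c1 *g h1 >> << c2 *g h2 >> = << c1 * c2 *g h1 + h2 >>.
Proof. by rewrite (mulw msuppU_le msuppU_le) !big_seq_fset1 !mcoeffUU. Qed.

Fact galg_mulDl : left_distributive galg_mul +%R.
Proof.
move=> g1 g2 g.
rewrite (mulw (msuppD_le g1 g2) (fsubset_refl _)).
rewrite [X in _ = X + _](mulw (fsubsetUl _ (msupp g2)) (fsubset_refl _)).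
rewrite [X in _ = _ + X](mulw (fsubsetUr (msupp g1) _) (fsubset_refl _)).
rewrite -big_split /=; apply/eq_bigr=> k1 _.
rewrite -big_split /=; apply/eq_bigr=> k2 _.
by rewrite mcoeffD mulrDl monalgUD.
Qed.
Fact galg_mulDr : right_distributive galg_mul +%R.
Proof. by move=> g g1 g2; rewrite !(galg_mulC g) galg_mulDl. Qed.

Let mul0g : left_zero 0 galg_mul.
Proof. by move=> g; rewrite /galg_mul msupp0 big_seq_fset0. Qed.
Let mulg0 : right_zero 0 galg_mul.
Proof. by move=> g; rewrite galg_mulC mul0g. Qed.
Let suml (I : Type) (r : seq I) (F : I -> galg) g :
  galg_mul (\sum_(i <- r) F i) g = \sum_(i <- r) galg_mul (F i) g.
Proof. exact: (big_morph (galg_mul^~ g) (fun _ _ => galg_mulDl _ _ _) (mul0g _)). Qed.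
Let sumr (I : Type) (r : seq I) (F : I -> galg) g :
  galg_mul g (\sum_(i <- r) F i) = \sum_(i <- r) galg_mul g (F i).
Proof. exact: (big_morph (galg_mul g) (fun _ _ => galg_mulDr _ _ _) (mulg0 _)). Qed.

Fact galg_mulA : associative galg_mul.
Proof.
move=> g1 g2 g3; rewrite (monalgE g1) (monalgE g2) (monalgE g3).
set x1 := \sum_(_ <- msupp g1) _; set x2 := \sum_(_ <- msupp g2) _.
set x3 := \sum_(_ <- msupp g3) _.
rewrite [LHS]suml [X in _ = galg_mul X _]suml [RHS]suml.
apply: eq_bigr => h1 _; rewrite [X in galg_mul _ X = _]suml [LHS]sumr.
rewrite [X in _ = galg_mul X _]sumr [RHS]suml; apply: eq_bigr => h2 _.
rewrite [X in galg_mul _ X = _]sumr [LHS]sumr [RHS]sumr.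
apply: eq_bigr => h3 _.
by rewrite !galg_mulUU mulrA addrA.
Qed.
Fact galg_mul1 : left_id (gu 0) galg_mul.
Proof.
move=> g; rewrite [in LHS](monalgE g) sumr [RHS]monalgE.
by apply: eq_bigr => h _; rewrite galg_mulUU mul1r add0r.
Qed.
Fact galg_mul1r : right_id (gu 0) galg_mul.
Proof. by move=> g; rewrite galg_mulC galg_mul1. Qed.
Fact galg_oner_neq0 : gu 0 != 0.
Proof. by apply/eqP/malgP => /(_ 0) /eqP; rewrite mcoeffUU mcoeff0 oner_eq0. Qed.

HB.instance Definition _ := GRing.Zmodule_isNzRing.Build galg
  galg_mulA galg_mul1 galg_mul1r galg_mulDl galg_mulDr galg_oner_neq0.
HB.instance Definition _ := GRing.Ring_hasCommutativeMul.Build galg galg_mulC.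

Fact galg_scaleE c g : c *: g = galg_mul << c *g 0 >> g.
Proof.
rewrite [in RHS](monalgE g) sumr -[LHS]/(fgscale c g) /fgscale.
by apply: eq_bigr => k _; rewrite galg_mulUU add0r.
Qed.
Fact galg_scaleAl (c : R) g1 g2 : c *: (g1 * g2) = (c *: g1) * g2.
Proof. by rewrite !galg_scaleE; apply: galg_mulA. Qed.

HB.instance Definition _ := GRing.Lmodule_isLalgebra.Build R galg galg_scaleAl.
HB.instance Definition _ := GRing.Lalgebra_isComAlgebra.Build R galg.

HB.instance Definition _ := Lmodule_isNUAlgebra.Build R galg
  (@mulrA galg) (@mulrDl galg) (@mulrDr galg)
  (fun a x y => esym (scalerAl a x y)) (fun a x y => esym (scalerAr a x y)).

Lemma gu0 : gu 0 = 1.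
Proof. by []. Qed.
Lemma guM h1 h2 : gu h1 * gu h2 = gu (h1 + h2).
Proof. by rewrite -[LHS]/(galg_mul _ _) galg_mulUU mulr1. Qed.

End GroupAlgebra.

Definition natz (k : nat) (n : 'rV[nat]_k) : 'rV[int]_k := map_mx Posz n.

Lemma natzD k (m n : 'rV[nat]_k) : natz (m + n) = natz m + natz n.
Proof. by apply/rowP => i; rewrite !mxE. Qed.
Lemma natz0 k : natz (0 : 'rV[nat]_k) = 0.
Proof. by apply/rowP => i; rewrite !mxE. Qed.
Lemma natz_inj k : injective (@natz k).
Proof. by move=> m n /rowP e; apply/rowP => i; have := e i; rewrite !mxE => -[]. Qed.

Definition intpos (z : int) : nat := if z is Posz n then n else 0%N.

Lemma zposK k (z : 'rV[int]_k) : natz (map_mx intpos z) - natz (map_mx intpos (- z)) = z.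
Proof.
apply/rowP => i; rewrite !mxE.
case: (z 0 i) => [[|n]|n] //=; by rewrite ?subr0 ?NegzE ?opprK ?sub0r.
Qed.

Section Completion.
Variables (k l : nat) (f : {additive 'rV[nat]_k -> 'rV[nat]_l}).

(* The extension of f to a group homomorphism, z |-> f (z^+) - f (z^-);
   gcompl_natz and gcompl_unique characterise it. *)
Definition gcompl (z : 'rV[int]_k) : 'rV[int]_l :=
  natz (f (map_mx intpos z)) - natz (f (map_mx intpos (- z))).

Lemma gcomplB (m n : 'rV[nat]_k) :
  gcompl (natz m - natz n) = natz (f m) - natz (f n).
Proof.
set z := natz m - natz n.
have e : map_mx intpos z + n = m + map_mx intpos (- z).
  apply: natz_inj; rewrite !natzD; apply/eqP; rewrite addrC -subr_eq.
  by rewrite -addrA zposK addrC subrK.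
apply/eqP; rewrite subr_eq addrAC eq_sym subr_eq -!natzD -!raddfD /=.
by rewrite e.
Qed.

Fact gcompl_zmod_morphism : zmod_morphism gcompl.
Proof.
move=> x y; rewrite -(zposK x) -(zposK y).
move: (map_mx _ x) (map_mx _ (- x)) (map_mx _ y) (map_mx _ (- y)) => a b c d.
have sub4 (V : zmodType) (p q r s : V) : p - q - (r - s) = p + s - (q + r).
  by rewrite opprB addrACA opprD.
by rewrite sub4 -!natzD !gcomplB sub4 -!natzD -!raddfD.
Qed.
HB.instance Definition _ :=
  GRing.isZmodMorphism.Build _ _ gcompl gcompl_zmod_morphism.

Lemma gcompl_natz n : gcompl (natz n) = natz (f n).
Proof. by rewrite -[natz n]subr0 -natz0 gcomplB raddf0 natz0 subr0. Qed.

Lemma gcompl_unique (g : {additive 'rV[int]_k -> 'rV[int]_l}) :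
  (forall n, g (natz n) = natz (f n)) -> g =1 gcompl.
Proof. by move=> gn z; rewrite -[in LHS](zposK z) raddfB /= !gn. Qed.

End Completion.

Section Kernel.
Variables (U V : zmodType) (phi : {additive U -> V}).

Definition kerp : {pred U} := fun x => phi x == 0.
Fact kerp_zmod_closed : zmod_closed kerp.
Proof.
split=> [|x y]; rewrite !unfold_in ?raddf0 // => /eqP ex /eqP ey.
by rewrite raddfB ex ey subrr.
Qed.
HB.instance Definition _ := GRing.isZmodClosed.Build U kerp kerp_zmod_closed.

Record kernel := Kernel { kerval : U; _ : kerval \in kerp }.
HB.instance Definition _ := [isSub for kerval].
HB.instance Definition _ := [Choice of kernel by <:].
HB.instance Definition _ := [SubChoice_isSubZmodule of kernel by <:].

Variables (j : {additive V -> U}).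

Lemma section_kerP (jK : cancel j phi) (x : U) (y : V) :
  phi x = y -> x - j y \in kerp.
Proof. by move=> e; rewrite unfold_in raddfB jK e subrr. Qed.

Definition section_ker (jK : cancel j phi) x y (e : phi x = y) : kernel :=
  Kernel (section_kerP jK e).

End Kernel.

(* The composite kg_comp x y stands for the product xy, defined when
   kg_s x = kg_r y; it is unconstrained, and never used, on other pairs. *)
Record kgraph (k : nat) := KGraph {
  kg_obj : countType;
  kg_mor : countType;
  kg_r : kg_mor -> kg_obj;
  kg_s : kg_mor -> kg_obj;
  kg_id : kg_obj -> kg_mor;
  kg_comp : kg_mor -> kg_mor -> kg_mor;
  kg_d : kg_mor -> 'rV[nat]_k;
  kg_r_id : forall v, kg_r (kg_id v) = v;
  kg_s_id : forall v, kg_s (kg_id v) = v;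
  kg_r_comp : forall x y, kg_s x = kg_r y -> kg_r (kg_comp x y) = kg_r x;
  kg_s_comp : forall x y, kg_s x = kg_r y -> kg_s (kg_comp x y) = kg_s y;
  kg_compA : forall x y z, kg_s x = kg_r y -> kg_s y = kg_r z ->
    kg_comp x (kg_comp y z) = kg_comp (kg_comp x y) z;
  kg_comp1m : forall x, kg_comp (kg_id (kg_r x)) x = x;
  kg_compm1 : forall x, kg_comp x (kg_id (kg_s x)) = x;
  kg_d_id : forall v, kg_d (kg_id v) = 0;
  kg_d_comp : forall x y, kg_s x = kg_r y ->
    kg_d (kg_comp x y) = kg_d x + kg_d y;
  kg_factorisation : forall x m n, kg_d x = m + n ->
    exists! p : kg_mor * kg_mor,
      [/\ kg_s p.1 = kg_r p.2, x = kg_comp p.1 p.2, kg_d p.1 = m & kg_d p.2 = n]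
}.

Definition row_finite k (L : kgraph k) := forall (v : kg_obj L) (n : 'rV[nat]_k),
  exists s : seq (kg_mor L), forall x, kg_r x = v -> kg_d x = n -> x \in s.

Definition no_sources k (L : kgraph k) := forall (v : kg_obj L) (n : 'rV[nat]_k),
  exists x : kg_mor L, kg_r x = v /\ kg_d x = n.

Section Pullback.
Variables (k l : nat) (f : {additive 'rV[nat]_k -> 'rV[nat]_l}) (G : kgraph l).

Definition pb_mor := {x : kg_mor G * 'rV[nat]_k | kg_d x.1 == f x.2}.
HB.instance Definition _ := Countable.on pb_mor.

Definition pb_path (x : pb_mor) : kg_mor G := (val x).1.
Definition pb_d (x : pb_mor) : 'rV[nat]_k := (val x).2.
Definition pb_r (x : pb_mor) : kg_obj G := kg_r (pb_path x).
Definition pb_s (x : pb_mor) : kg_obj G := kg_s (pb_path x).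

Lemma pb_pathP x : kg_d (pb_path x) = f (pb_d x).
Proof. by apply/eqP; case: x. Qed.

Fact pb_id_subproof v : kg_d (@kg_id l G v) == f 0.
Proof. by rewrite kg_d_id raddf0. Qed.
Definition pb_id (v : kg_obj G) : pb_mor :=
  exist _ (kg_id v, 0) (pb_id_subproof v).

(* insubd only matters for pairs that are not composable: see pb_compE *)
Definition pb_comp (x y : pb_mor) : pb_mor :=
  insubd x (kg_comp (pb_path x) (pb_path y), pb_d x + pb_d y).

Lemma pb_compE x y : pb_s x = pb_r y ->
  val (pb_comp x y) = (kg_comp (pb_path x) (pb_path y), pb_d x + pb_d y).
Proof.
by move=> e; rewrite insubdK // unfold_in /= kg_d_comp // raddfD !pb_pathP.
Qed.

Lemma pb_ext x y : pb_path x = pb_path y -> pb_d x = pb_d y -> x = y.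
Proof.
rewrite /pb_path /pb_d => e1 e2; apply: val_inj.
by rewrite [val x]surjective_pairing [val y]surjective_pairing e1 e2.
Qed.

Lemma pb_path_comp x y : pb_s x = pb_r y ->
  pb_path (pb_comp x y) = kg_comp (pb_path x) (pb_path y).
Proof. by move=> e; rewrite /pb_path pb_compE. Qed.
Lemma pb_d_comp x y : pb_s x = pb_r y -> pb_d (pb_comp x y) = pb_d x + pb_d y.
Proof. by move=> e; rewrite /pb_d pb_compE. Qed.
Lemma pb_r_comp x y : pb_s x = pb_r y -> pb_r (pb_comp x y) = pb_r x.
Proof. by move=> e; rewrite /pb_r pb_path_comp // kg_r_comp. Qed.
Lemma pb_s_comp x y : pb_s x = pb_r y -> pb_s (pb_comp x y) = pb_s y.
Proof. by move=> e; rewrite /pb_s pb_path_comp // kg_s_comp. Qed.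
Lemma pb_r_id v : pb_r (pb_id v) = v. Proof. exact: kg_r_id. Qed.
Lemma pb_s_id v : pb_s (pb_id v) = v. Proof. exact: kg_s_id. Qed.

Lemma pb_compA x y z : pb_s x = pb_r y -> pb_s y = pb_r z ->
  pb_comp x (pb_comp y z) = pb_comp (pb_comp x y) z.
Proof.
move=> exy eyz; have e1 : pb_s x = pb_r (pb_comp y z) by rewrite pb_r_comp.
have e2 : pb_s (pb_comp x y) = pb_r z by rewrite pb_s_comp.
apply: pb_ext; first by rewrite !pb_path_comp // kg_compA.
by rewrite !pb_d_comp // addrA.
Qed.
Lemma pb_comp1m x : pb_comp (pb_id (pb_r x)) x = x.
Proof.
have e : pb_s (pb_id (pb_r x)) = pb_r x by rewrite pb_s_id.
apply: pb_ext; first by rewrite pb_path_comp // [LHS]kg_comp1m.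
by rewrite pb_d_comp // add0r.
Qed.
Lemma pb_compm1 x : pb_comp x (pb_id (pb_s x)) = x.
Proof.
have e : pb_s x = pb_r (pb_id (pb_s x)) by rewrite pb_r_id.
apply: pb_ext; first by rewrite pb_path_comp // [LHS]kg_compm1.
by rewrite pb_d_comp // addr0.
Qed.

Lemma pb_factorisation x m n : pb_d x = m + n ->
  exists! p : pb_mor * pb_mor,
    [/\ pb_s p.1 = pb_r p.2, x = pb_comp p.1 p.2, pb_d p.1 = m & pb_d p.2 = n].
Proof.
move=> e; have := pb_pathP x; rewrite e raddfD.
move=> /kg_factorisation [[y z] /= [[eyz exyz dy dz] u]].
have py : kg_d y == f m by apply/eqP.
have pz : kg_d z == f n by apply/eqP.
pose y' : pb_mor := exist _ (y, m) py; pose z' : pb_mor := exist _ (z, n) pz.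
have eyz' : pb_s y' = pb_r z' by [].
exists (y', z'); split=> [|[a b] /= [eab exab da db]].
  by split=> //; apply: pb_ext; rewrite ?pb_path_comp ?pb_d_comp.
have [ya zb] : (y, z) = (pb_path a, pb_path b).
  by apply: u; rewrite /= !pb_pathP da db; split=> //; rewrite exab pb_path_comp.
by congr (_, _); apply: pb_ext.
Qed.

(* The vertex (v, 0) is represented by v. *)
Definition pullback : kgraph k :=
  @KGraph k (kg_obj G) pb_mor pb_r pb_s pb_id pb_comp pb_d pb_r_id pb_s_id
    pb_r_comp pb_s_comp pb_compA pb_comp1m pb_compm1 (fun=> erefl) pb_d_comp
    pb_factorisation.

Lemma gcompl_pb_d (x : kg_mor pullback) :
  gcompl f (natz (pb_d x)) = natz (kg_d (pb_path x)).
Proof. by rewrite gcompl_natz pb_pathP. Qed.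

End Pullback.

Section KumjianPask.
Variables (R : comPzRingType) (k : nat) (L : kgraph k).

(* GenS and GenSs range over all paths; the convention s_v = s_{v^*} = p_v for
   vertices is imposed by the first two relations below. *)
Inductive kp_gen : Type :=
| GenP of kg_obj L
| GenS of kg_mor L
| GenSs of kg_mor L.

Local Notation term := (aterm R kp_gen).
Local Notation P v := (TGen R (GenP v)).
Local Notation S x := (TGen R (GenS x)).
Local Notation Ss x := (TGen R (GenSs x)).

Definition tsum (ts : seq term) : term := foldr (@TAdd R kp_gen) TZero ts.

Inductive kp_rel : term -> term -> Prop :=
| kp0_s v : kp_rel (S (kg_id v)) (P v)
| kp0_ss v : kp_rel (Ss (kg_id v)) (P v)
| kp1_idem v : kp_rel (TMul (P v) (P v)) (P v)
| kp1_orth v w : v <> w -> kp_rel (TMul (P v) (P w)) TZero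
| kp2_s x y : kg_s x = kg_r y ->
    kp_rel (TMul (S x) (S y)) (S (kg_comp x y))
| kp2_ss x y : kg_s x = kg_r y ->
    kp_rel (TMul (Ss y) (Ss x)) (Ss (kg_comp x y))
| kp2_ps x : kp_rel (TMul (P (kg_r x)) (S x)) (S x)
| kp2_sp x : kp_rel (TMul (S x) (P (kg_s x))) (S x)
| kp2_pss x : kp_rel (TMul (P (kg_s x)) (Ss x)) (Ss x)
| kp2_ssp x : kp_rel (TMul (Ss x) (P (kg_r x))) (Ss x)
| kp3_eq x : kp_rel (TMul (Ss x) (S x)) (P (kg_s x))
| kp3_neq x y : kg_d x = kg_d y -> x <> y -> kp_rel (TMul (Ss x) (S y)) TZero
| kp4 v n (E : seq (kg_mor L)) :
    (* E enumerates the finite set of paths of degree n with range v *)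
    n <> 0 -> uniq E -> (forall x, x \in E <-> kg_r x = v /\ kg_d x = n) ->
    kp_rel (P v) (tsum [seq TMul (S x) (Ss x) | x <- E]).

Definition KP := pres_alg kp_rel.
HB.instance Definition _ := NUAlgebra.on KP.

Definition kp_p (v : kg_obj L) : KP := pres_gen kp_rel (GenP v).
Definition kp_s (x : kg_mor L) : KP := pres_gen kp_rel (GenS x).
Definition kp_ss (x : kg_mor L) : KP := pres_gen kp_rel (GenSs x).

End KumjianPask.

Arguments kp_p R {k L} v.
Arguments kp_s R {k L} x.
Arguments kp_ss R {k L} x.

Section Gradings.
Variables (R : comPzRingType) (G : zmodType).

Definition lspan (V : lmodType R) (P : V -> Prop) (x : V) : Prop :=
  exists (n : nat) (a : 'I_n -> R) (v : 'I_n -> V),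
    (forall i, P (v i)) /\ x = \sum_(i < n) a i *: v i.

(* A is the internal direct sum of the submodules D g, compatibly with the
   product. *)
Definition is_grading (A : nuAlgType R) (D : G -> A -> Prop) : Prop :=
  [/\ forall g, D g 0 /\ forall a x y, D g x -> D g y -> D g (a *: x + y),
      forall g h x y, D g x -> D h y -> D (g + h) (x ** y),
      forall x, exists (gs : seq G) (y : G -> A),
        (forall g, D g (y g)) /\ x = \sum_(g <- gs) y g
    & forall (gs : seq G) (y : G -> A), uniq gs -> (forall g, D g (y g)) ->
        \sum_(g <- gs) y g = 0 -> forall g, g \in gs -> y g = 0].

Definition alg_hom (A B : nuAlgType R) (F : {linear A -> B}) : Prop :=
  {morph F : x y / x ** y}.

Definition graded_iso (A B : nuAlgType R) (D : G -> A -> Prop)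
    (E : G -> B -> Prop) (F : {linear A -> B}) : Prop :=
  [/\ is_grading D, is_grading E, alg_hom F, bijective F
    & forall g x, D g x <-> E g (F x)].

End Gradings.

Definition kp_deg (R : comPzRingType) k (L : kgraph k) (q : 'rV[int]_k) :
    KP R L -> Prop :=
  lspan (fun z => exists x y : kg_mor L,
    natz (kg_d x) - natz (kg_d y) = q /\ z = kp_s R x ** kp_ss R y).
Arguments kp_deg R {k} L q.

(* The image of P (x) Q in A (x) B, for submodules P and Q. *)
Definition tens_sub (R : comPzRingType) (A B : lmodType R)
    (P : A -> Prop) (Q : B -> Prop) : tensor A B -> Prop :=
  lspan (fun z => exists x y, [/\ P x, Q y & z = x \ox y]).

Section Theta.
Variables (K : fieldType) (k l : nat) (G : kgraph l).
Variables (f : {additive 'rV[nat]_k -> 'rV[nat]_l}).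
Variables (j : {additive 'rV[int]_l -> 'rV[int]_k}).
Hypothesis jK : cancel j (gcompl f).

Definition Hker := kernel (gcompl f).
HB.instance Definition _ := GRing.Zmodule.on Hker.

Definition theta_cod := tensor (KP K G) (galg K Hker).
HB.instance Definition _ := NUAlgebra.on theta_cod.

(* g - j (fbar g) *)
Definition hdeg (g : 'rV[int]_k) : Hker :=
  section_ker jK (erefl (gcompl f g)).

(* n - j (d x), for a path (x, n) of the pullback *)
Definition hpath (x : kg_mor (pullback f G)) : Hker :=
  section_ker jK (gcompl_pb_d x).

Definition theta_deg (g : 'rV[int]_k) : theta_cod -> Prop :=
  tens_sub (kp_deg K G (gcompl f g)) (lspan (fun z => z = gu K (hdeg g))).

Definition theta_spec (T : {linear KP K (pullback f G) -> theta_cod}) : Prop :=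
  [/\ forall v : kg_obj G, T (kp_p K (v : kg_obj (pullback f G))) = kp_p K v \ox 1,
      forall x, T (kp_s K x) = kp_s K (pb_path x) \ox gu K (hpath x)
    & forall x, T (kp_ss K x) = kp_ss K (pb_path x) \ox gu K (- hpath x)].

End Theta.

(* Main.v *)
Require Import Defs.
From HB Require Import structures.
From mathcomp Require Import all_boot all_order all_algebra.
From mathcomp Require Import boolp monalg.

(** Write A = KP(f^*Gamma) and B = KP(Gamma). The defining relations of A hold
    for the images s_x (x) u_(n - j(d x)) in B (x) K[H] of the generators
    s_((x, n)): projecting (x, n) to x is injective in each degree and lifts
    paths, so that it respects (KP3) and (KP4), and n - j(d x) is additive
    under composition. The universal property gives Theta and its uniqueness
    (kp_twist).

    Both algebras are graded by Z^k. A degree g amounts to the pair formed by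
    q = fbar(g) in Z^l and h = g - j(q) in H (deg_split), so that the components
    D_g = B_q (x) u_h are independent because those of B are. The components of
    a Kumjian-Pask algebra are themselves independent because s_x |-> s_x (x)
    u_(d x) defines a homomorphism to KP (x) R[Z^k], the coaction
    (kp_coaction), which is the same construction applied to the identity.

    Theta is onto, degree by degree (T_deg_lift): an element of B_q is, by
    (KP4), a combination of products s_x s_y^* with d x = f(n) and d y = f(m),
    for suitable n, m in N^k with n - m = g, and these paths lift to A.

    Theta is injective by graded uniqueness (graded_uniqueness): a kernel element
    may be taken homogeneous, hence a combination of products s_x s_y^* with d x
    and d y fixed; these multiply like matrix units, so each coefficient c
    satisfies c Theta(p_v) = 0 for some v. Finally c p_v = 0 in B forces c = 0
    (kp_p_torsionfree). To see this, s_x acts on functions on paths by shifting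
    along x, and (KP4) holds for this action as soon as functions that agree on
    all long paths are identified; since there are no sources, p_v moves the
    constant function 1 to a function that is nonzero on arbitrarily long
    paths. *)

Set Implicit Arguments.
Unset Strict Implicit.
Unset Printing Implicit Defensive.

Import GRing.Theory.
Local Open Scope ring_scope.

(* the embedding of N^k into Z^k, hidden by the one of nat into int *)
Local Notation natz := Defs.natz.

(** * Linear spans *)

Section Span.
Variables (R : comPzRingType) (V : lmodType R).
Implicit Types (P Q : V -> Prop) (x y : V).

Lemma lspan_mem P x : P x -> lspan P x.
Proof.
by move=> Px; exists 1%N, (fun=> 1), (fun=> x); rewrite big_ord1 scale1r.
Qed.

Lemma lspan0 P : lspan P 0.
Proof.
by exists 0%N, (fun=> 0), (fun=> 0); rewrite big_ord0; split=> // -[].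
Qed.

Lemma lspanP P a x y : lspan P x -> lspan P y -> lspan P (a *: x + y).
Proof.
move=> [m [b [v [Pv ->]]]] [n [c [w [Pw ->]]]]; exists (m + n)%N.
exists (fun i => match split i with inl s => a * b s | inr t => c t end).
exists (fun i => match split i with inl s => v s | inr t => w t end).
split=> [i|]; first by case: (split i).
rewrite big_split_ord scaler_sumr; congr (_ + _); apply: eq_bigr => i _.
- by have /= -> := unsplitK (inl i : 'I_m + 'I_n); rewrite scalerA.
- by have /= -> := unsplitK (inr i : 'I_m + 'I_n).
Qed.

Lemma lspanD P x y : lspan P x -> lspan P y -> lspan P (x + y).
Proof. by move=> Px Py; rewrite -[x]scale1r; apply: lspanP. Qed.

Lemma lspanZ P a x : lspan P x -> lspan P (a *: x).
Proof. by move=> Px; rewrite -[_ *: _]addr0; apply/lspanP/lspan0. Qed.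

Lemma lspan_sum P (I : eqType) (s : seq I) (F : I -> V) :
  (forall i, i \in s -> lspan P (F i)) -> lspan P (\sum_(i <- s) F i).
Proof.
move=> PF; rewrite big_seq; apply: (big_ind (lspan P)) => //.
- exact: lspan0.
- exact: lspanD.
Qed.

Lemma lspan_rect P Q : Q 0 ->
    (forall a x y, Q x -> Q y -> Q (a *: x + y)) -> (forall x, P x -> Q x) ->
  forall x, lspan P x -> Q x.
Proof.
move=> Q0 QP PQ _ [n [a [v [Pv ->]]]]; apply: (big_ind Q) => //.
- by move=> x y Qx Qy; rewrite -[x]scale1r; apply: QP.
- by move=> i _; rewrite -[_ *: _]addr0; apply: QP => //; apply: PQ.
Qed.

Lemma lspan_sub P Q x : (forall y, P y -> lspan Q y) -> lspan P x -> lspan Q x.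
Proof.
by move=> PQ; apply: lspan_rect x => [|a x y|//]; [exact: lspan0|exact: lspanP].
Qed.

(** Collecting equal indices matters when coefficients are to be read off one
    by one: an element of a span is given with repetitions. *)
Lemma lspan_uniq (I : eqType) (p : I -> Prop) (e : I -> V) x :
    lspan (fun z => exists i, p i /\ z = e i) x ->
  exists (s : seq I) (c : I -> R),
    [/\ uniq s, forall i, i \in s -> p i & x = \sum_(i <- s) c i *: e i].
Proof.
have fam n : forall (a : 'I_n -> R) (v : 'I_n -> V),
    (forall i, exists h, p h /\ v i = e h) ->
  exists (s : seq I) (c : I -> R), [/\ uniq s, forall i, i \in s -> p i &
    \sum_(i < n) a i *: v i = \sum_(i <- s) c i *: e i].
  elim: n => [|n IH] a v pv.
    by exists [::], (fun=> 0); rewrite big_ord0 big_nil.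
  have [|s [c [us ps Es]]] := IH (a \o lift ord0) (v \o lift ord0).
    by move=> i; apply: pv.
  have [h [ph vh]] := pv ord0; rewrite big_ord_recl {}Es {}vh.
  case: (boolP (h \in s)) => hs.
    exists s, (fun i => if i == h then a ord0 + c h else c i); split=> //.
    rewrite [LHS]addrC (big_rem h hs) [RHS](big_rem h hs) /= eqxx scalerDl.
    rewrite addrC addrA; congr (_ + _); rewrite !big_seq; apply: eq_bigr => i.
    by rewrite mem_rem_uniq // inE => /andP[/negPf -> _].
  exists (h :: s), (fun i => if i == h then a ord0 else c i); split.
  - by rewrite /= hs.
  - by move=> i; rewrite inE => /predU1P[->|/ps].
  - rewrite big_cons eqxx; congr (_ + _); rewrite !big_seq.
    by apply: eq_bigr => i is_; case: eqP => // ih; rewrite -ih is_ in hs.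
by case=> [n [a [v [pv ->]]]]; apply: fam.
Qed.

End Span.

Lemma lspan_map (R : comPzRingType) (V W : lmodType R) (F : {linear V -> W})
    (P : V -> Prop) (Q : W -> Prop) x :
  (forall y, P y -> lspan Q (F y)) -> lspan P x -> lspan Q (F x).
Proof.
move=> PQ; move: x; apply: lspan_rect => [|a x y Qx Qy|x Px]; last exact: PQ.
- by rewrite linear0; apply: lspan0.
- by rewrite linearP; apply: lspanP.
Qed.

(** * Nonunital algebras and their tensor products with a group algebra *)

Section NonunitalAlgebra.
Variables (R : comPzRingType) (A : nuAlgType R).

Fact numul_linear (x : A) : linear (numul x).
Proof. by move=> a y z; rewrite numulDr numulZr. Qed.
Fact numulr_linear (y : A) : linear (fun x => x ** y).
Proof. by move=> a x z; rewrite numulDl numulZl. Qed.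

Definition lmul (x : A) : {linear A -> A} := HB.pack (numul x)
  (GRing.isLinear.Build R A A _ (numul x) (numul_linear x)).
Definition rmul (y : A) : {linear A -> A} := HB.pack (fun x => x ** y)
  (GRing.isLinear.Build R A A _ (fun x => x ** y) (numulr_linear y)).

Lemma numul0r (x : A) : x ** 0 = 0.
Proof. exact: (linear0 (lmul x)). Qed.
Lemma numul0l (x : A) : 0 ** x = 0.
Proof. exact: (linear0 (rmul x)). Qed.
Lemma numul_sumr (I : Type) (s : seq I) (F : I -> A) (x : A) :
  x ** (\sum_(i <- s) F i) = \sum_(i <- s) x ** F i.
Proof. exact: (linear_sum (lmul x)). Qed.
Lemma numul_suml (I : Type) (s : seq I) (F : I -> A) (x : A) :
  (\sum_(i <- s) F i) ** x = \sum_(i <- s) F i ** x.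
Proof. exact: (linear_sum (rmul x)). Qed.

End NonunitalAlgebra.

Section GroupAlgebraCoefficient.
Variables (R : comNzRingType) (H : zmodType) (A : lmodType R).
Implicit Types (h : H) (x : A) (g : galg R H).

Let coef_bilin h x g : A := mcoeff h g *: x.

(** The group algebra is free on the basis of the u_h, so that the coefficient
    of u_h extends to every tensor product with it. *)
Definition tens_coef h : tensor A (galg R H) -> A := tens_lift (coef_bilin h).

Fact coef_bilin_axioms h :
  [/\ forall x x' g, coef_bilin h (x + x') g = coef_bilin h x g + coef_bilin h x' g,
      forall x g g', coef_bilin h x (g + g') = coef_bilin h x g + coef_bilin h x g',
      forall a x g, coef_bilin h (a *: x) g = a *: coef_bilin h x g
    & forall a x g, coef_bilin h x (a *: g) = a *: coef_bilin h x g].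
Proof.
rewrite /coef_bilin; split=> *.
- exact: scalerDr.
- by rewrite mcoeffD scalerDl.
- by rewrite !scalerA mulrC.
- by rewrite mcoeffZ scalerA.
Qed.

Fact tens_coef_linear h : linear (tens_coef h).
Proof. by have [? ? ? ?] := coef_bilin_axioms h; apply: tens_lift_linear. Qed.
HB.instance Definition _ h :=
  GRing.isLinear.Build R _ _ _ (tens_coef h) (tens_coef_linear h).

Lemma tens_coef_gu h h' x : tens_coef h (x \ox gu R h') = x *+ (h' == h).
Proof.
have [? ? ? ?] := coef_bilin_axioms h.
rewrite /tens_coef tens_lift_tens // /coef_bilin mcoeffU.
by case: eqP; rewrite ?scale1r ?scale0r.
Qed.

Lemma galg_span g : lspan (fun z => exists h, z = gu R h) g.
Proof.
rewrite [g]monalgE; apply: lspan_sum => h _.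
have -> : << g@_h *g h >> = g@_h *: gu R h.
  by apply/malgP => i; rewrite mcoeffZ !mcoeffU mulrnAr mulr1.
by apply/lspanZ/lspan_mem; exists h.
Qed.

End GroupAlgebraCoefficient.

(** C is A (x) R[H]: here ge_tens h x is x (x) u_h, and ge_coef h is the
    coefficient of u_h. These rules are all that the theory of the isomorphism
    uses, and they keep the construction of the tensor product out of sight. *)
Record group_extension (R : comPzRingType) (A : nuAlgType R) (H : zmodType)
    (C : nuAlgType R) := GroupExtension {
  ge_tens : H -> {linear A -> C};
  ge_coef : H -> {linear C -> A};
  ge_tensM : forall h h' x y,
    ge_tens h x ** ge_tens h' y = ge_tens (h + h') (x ** y);
  ge_coef_tens : forall h h' x, ge_coef h (ge_tens h' x) = x *+ (h' == h);
  ge_span : forall z, lspan (fun z => exists h x, z = ge_tens h x) z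
}.

Section TensorExtension.
Variables (R : comNzRingType) (A : nuAlgType R) (H : zmodType).

Fact tens_gu_linear h : linear (fun x : A => x \ox gu R h : tensor A (galg R H)).
Proof. by move=> a x y; rewrite tensDl tensZl. Qed.
Definition tens_gu (h : H) : {linear A -> tensor A (galg R H)} :=
  HB.pack (fun x : A => x \ox gu R h) (GRing.isLinear.Build R A
    (tensor A (galg R H)) _ (fun x : A => x \ox gu R h) (tens_gu_linear h)).

Fact tens_gu_mul h h' x y : tens_gu h x ** tens_gu h' y = tens_gu (h + h') (x ** y).
Proof. by rewrite /= tensM -guM. Qed.

Fact tens_gu_span z : lspan (fun z => exists h x, z = tens_gu h x) z.
Proof.
elim/tens_ind: z => [x y||z z'|a z]; [|exact: lspan0|exact: lspanD|exact: lspanZ].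
have lin : linear (fun y : galg R H => x \ox y).
  by move=> a u v; rewrite tensDr tensZr.
pose F : {linear galg R H -> tensor A (galg R H)} := HB.pack
  (fun y : galg R H => x \ox y)
  (GRing.isLinear.Build R _ _ _ (fun y : galg R H => x \ox y) lin).
apply: (lspan_map (F := F)) (galg_span y) => _ [h ->].
by apply: lspan_mem; exists h, x.
Qed.

Definition tensor_extension : group_extension A H (tensor A (galg R H)) :=
  GroupExtension (ge_tens := tens_gu) (ge_coef := @tens_coef R H A)
    tens_gu_mul (@tens_coef_gu R H A) tens_gu_span.

Lemma tens_sub_gu (P : A -> Prop) h z : P 0 ->
    (forall a x y, P x -> P y -> P (a *: x + y)) ->
  tens_sub P (lspan (fun u => u = gu R h)) z <->
    exists x, P x /\ z = ge_tens tensor_extension h x.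
Proof.
move=> P0 PP; split=> [|[x [Px ->]]]; last first.
  by apply: lspan_mem; exists x, (gu R h); split=> //; apply: lspan_mem.
have zero : exists x, P x /\ 0 = tens_gu h x by exists 0; rewrite linear0.
have comb a u v : (exists x, P x /\ u = tens_gu h x) ->
    (exists x, P x /\ v = tens_gu h x) ->
  exists x, P x /\ a *: u + v = tens_gu h x.
  move=> [x [Px ->]] [y [Py ->]]; exists (a *: x + y).
  by rewrite linearP; split=> //; apply: PP.
move: z; apply: lspan_rect => // _ [x [u [Px + ->]]].
move: u; apply: lspan_rect => [|a u v xu xv|u ->]; last by exists x.
- by rewrite -(scale0r 0) tensZr scale0r.
- by rewrite tensDr tensZr; apply: comb.
Qed.

End TensorExtension.

(** * Kumjian-Pask algebras *)

Section Relations.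
Variables (R : comPzRingType) (k : nat) (L : kgraph k).
Implicit Types (v w : kg_obj L) (x y : kg_mor L) (n : 'rV[nat]_k).
Local Notation p v := (kp_p R v).
Local Notation s x := (kp_s R x).
Local Notation t x := (kp_ss R x).

Let relE (a b : aterm R (kp_gen L)) :
  kp_rel a b -> pres_pi (@kp_rel R k L) a = pres_pi (@kp_rel R k L) b.
Proof. by move=> ab; apply/pres_piP/acong_rel. Qed.

Lemma kp_s_id v : s (kg_id v) = p v.
Proof. exact/relE/kp0_s. Qed.
Lemma kp_ss_id v : t (kg_id v) = p v.
Proof. exact/relE/kp0_ss. Qed.
Lemma kp_pp v : p v ** p v = p v.
Proof. by rewrite -pres_piM; apply/relE/kp1_idem. Qed.
Lemma kp_pp0 v w : v <> w -> p v ** p w = 0.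
Proof. by move=> vw; rewrite -pres_piM; apply/relE/kp1_orth. Qed.
Lemma kp_sM x y : kg_s x = kg_r y -> s x ** s y = s (kg_comp x y).
Proof. by move=> xy; rewrite -pres_piM; apply/relE/kp2_s. Qed.
Lemma kp_ssM x y : kg_s x = kg_r y -> t y ** t x = t (kg_comp x y).
Proof. by move=> xy; rewrite -pres_piM; apply/relE/kp2_ss. Qed.
Lemma kp_ps x : p (kg_r x) ** s x = s x.
Proof. by rewrite -pres_piM; apply/relE/kp2_ps. Qed.
Lemma kp_sp x : s x ** p (kg_s x) = s x.
Proof. by rewrite -pres_piM; apply/relE/kp2_sp. Qed.
Lemma kp_pss x : p (kg_s x) ** t x = t x.
Proof. by rewrite -pres_piM; apply/relE/kp2_pss. Qed.
Lemma kp_ssp x : t x ** p (kg_r x) = t x.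
Proof. by rewrite -pres_piM; apply/relE/kp2_ssp. Qed.
Lemma kp_sss x : t x ** s x = p (kg_s x).
Proof. by rewrite -pres_piM; apply/relE/kp3_eq. Qed.
Lemma kp_sss0 x y : kg_d x = kg_d y -> x <> y -> t x ** s y = 0.
Proof. by move=> dxy xy; rewrite -pres_piM; apply/relE/kp3_neq. Qed.

Lemma kg_d0 x : kg_d x = 0 -> x = kg_id (kg_r x).
Proof.
move=> dx; have dx0 : kg_d x = 0 + 0 by rewrite addr0.
have [q [_ uniq_q]] := kg_factorisation dx0.
have q1 : q = (kg_id (kg_r x), x).
  by apply: uniq_q; rewrite /= kg_s_id kg_comp1m kg_d_id.
have q2 : q = (x, kg_id (kg_s x)).
  by apply: uniq_q; rewrite /= kg_r_id kg_compm1 kg_d_id.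
by move: q2; rewrite q1 => -[].
Qed.

(** In degree 0, which (KP4) leaves out, the sum has the one term given by the
    vertex itself. *)
Lemma kp_psum v n (E : seq (kg_mor L)) : uniq E ->
    (forall x, x \in E <-> kg_r x = v /\ kg_d x = n) ->
  p v = \sum_(x <- E) s x ** t x.
Proof.
move=> uE EP; have [n0|/eqP n0] := eqVneq n 0.
  have mE x : (x \in E) = (x == kg_id v).
    apply/idP/eqP => [/EP[<-] dx|->]; first by apply: kg_d0; rewrite dx.
    by apply/EP; rewrite kg_r_id kg_d_id n0.
  have pE : perm_eq E [:: kg_id v].
    by apply: uniq_perm => // x; rewrite mE inE.
  by rewrite (perm_big _ pE) big_seq1 kp_s_id kp_ss_id kp_pp.
transitivity (pres_pi (@kp_rel R k L) (tsum
    [seq TMul (TGen R (GenS x)) (TGen R (GenSs x)) | x <- E])).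
  exact: relE (kp4 R n0 uE EP).
elim: (E) => [|x E' IH]; first by rewrite big_nil.
by rewrite big_cons [LHS]pres_piD pres_piM -IH.
Qed.

Lemma kp_s_ss0 x y : kg_s x <> kg_s y -> s x ** t y = 0.
Proof.
by move=> xy; rewrite -kp_sp -kp_pss numulA -(numulA (s x)) kp_pp0 // numul0r numul0l.
Qed.

Lemma kp_ss_s0 x y : kg_r x <> kg_r y -> t x ** s y = 0.
Proof.
by move=> xy; rewrite -kp_ssp -kp_ps numulA -(numulA (t x)) kp_pp0 // numul0r numul0l.
Qed.

Lemma kg_fact x m n : kg_d x = m + n -> exists y z,
  [/\ kg_s y = kg_r z, x = kg_comp y z, kg_d y = m & kg_d z = n].
Proof. by move/kg_factorisation => [[y z] [/= yz _]]; exists y, z. Qed.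

Lemma kg_cancel x y x' y' : kg_s x = kg_r y -> kg_s x' = kg_r y' ->
  kg_d x = kg_d x' -> kg_d y = kg_d y' ->
  kg_comp x y = kg_comp x' y' -> x = x' /\ y = y'.
Proof.
move=> xy xy' dx dy e.
have [q [_ uniq_q]] := kg_factorisation (kg_d_comp xy).
have q1 : q = (x, y) by apply: uniq_q.
have : q = (x', y') by apply: uniq_q.
by rewrite q1 => -[].
Qed.

(** A path of degree d(x) + n either extends x or is orthogonal to it. *)
Lemma kp_ss_s_prefix x y n : kg_d y = kg_d x + n ->
  t x ** s y = 0 /\ t y ** s x = 0 \/ exists z, [/\ kg_d z = n, kg_s x = kg_r z,
    y = kg_comp x z, t x ** s y = s z & t y ** s x = t z].
Proof.
move=> dy; have [x' [z [xz -> dx dz]]] := kg_fact dy.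
have [xx|/eqP xx] := eqVneq x x'; last first.
  left; split; first by rewrite -kp_sM // numulA kp_sss0 // numul0l.
  by rewrite -kp_ssM // -numulA kp_sss0 ?numul0r // => /esym.
right; exists z; rewrite xx; split=> //.
- by rewrite -kp_sM // numulA kp_sss xz kp_ps.
- by rewrite -kp_ssM // -numulA kp_sss xz kp_ssp.
Qed.

Lemma kp_s_s0 x y : kg_s x <> kg_r y -> s x ** s y = 0.
Proof.
by move=> xy; rewrite -(kp_sp x) -(kp_ps y) numulA -(numulA (s x)) kp_pp0 // numul0r numul0l.
Qed.

Lemma kp_ss_ss0 x y : kg_s x <> kg_r y -> t y ** t x = 0.
Proof.
move=> xy; rewrite -(kp_ssp y) -(kp_pss x) numulA -(numulA (t y)) kp_pp0 ?numul0r ?numul0l //.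
exact: nesym.
Qed.

Hypothesis Lfin : row_finite L.

Lemma kg_enum v n : exists E : seq (kg_mor L),
  uniq E /\ forall x, x \in E <-> kg_r x = v /\ kg_d x = n.
Proof.
have [E inE] := Lfin v n.
exists (undup [seq x <- E | (kg_r x == v) && (kg_d x == n)]).
split=> [|x]; first exact: undup_uniq.
rewrite mem_undup mem_filter; split=> [/andP[/andP[/eqP-> /eqP->]]//|[xv xn]].
by rewrite xv xn !eqxx inE.
Qed.

(** The paths s_x s_y^* with d(x) = m, d(y) = n behave like the matrix units of
    one rectangular block. *)
Definition kp_unit m n (z : KP R L) := exists q : kg_mor L * kg_mor L,
  [/\ kg_s q.1 = kg_s q.2, kg_d q.1 = m & kg_d q.2 = n] /\ z = s q.1 ** t q.2.
Definition kp_block m n : KP R L -> Prop := lspan (kp_unit m n).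

Lemma kp_s_ss_block x y : kp_block (kg_d x) (kg_d y) (s x ** t y).
Proof.
have [xy|/eqP xy] := eqVneq (kg_s x) (kg_s y).
  by apply: lspan_mem; exists (x, y).
by rewrite kp_s_ss0 //; apply: lspan0.
Qed.

(** Inserting (KP4) in degree d(x) + d(y) between s_x^* and s_y turns the
    product into a sum over the common extensions of x and y. *)
Lemma kp_ss_s_block x y : kp_block (kg_d y) (kg_d x) (t x ** s y).
Proof.
have [xy|/eqP xy] := eqVneq (kg_r x) (kg_r y); last first.
  by rewrite kp_ss_s0 //; apply: lspan0.
have [E [uE EP]] := kg_enum (kg_r x) (kg_d x + kg_d y).
rewrite -kp_ssp -numulA (kp_psum uE EP) numul_suml numul_sumr.
apply: lspan_sum => z /EP [rz dz].
have {rz} -> : t x ** (s z ** t z ** s y) = t x ** s z ** (t z ** s y).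
  by rewrite !numulA.
have [[-> _]|[a [<- _ _ -> _]]] := kp_ss_s_prefix dz.
  by rewrite numul0l; apply: lspan0.
have {}dz : kg_d z = kg_d y + kg_d x by rewrite addrC.
have [[_ ->]|[b [<- _ _ _ ->]]] := kp_ss_s_prefix dz.
  by rewrite numul0r; apply: lspan0.
exact: kp_s_ss_block.
Qed.

(** Refinement of a block: (KP4) is inserted between s_x and s_y^*. *)
Lemma kp_block_refine m n c (z : KP R L) : kp_block m n z -> kp_block (m + c) (n + c) z.
Proof.
apply: lspan_sub => _ [[x y] /= [[xy dx dy] ->]].
have [E [uE EP]] := kg_enum (kg_s x) c.
rewrite -kp_sp -numulA (kp_psum uE EP) numul_suml numul_sumr.
apply: lspan_sum => w /EP [rw dw]; rewrite -[s w ** t w ** _]numulA numulA.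
rewrite kp_sM // kp_ssM -?xy //; apply: lspan_mem.
exists (kg_comp x w, kg_comp y w); split=> //=.
by rewrite !kg_s_comp -?xy // !kg_d_comp -?xy // dx dy dw.
Qed.

(** A homogeneous element lives in one block, as finitely many blocks of the
    same degree have a common refinement. *)
Lemma kp_deg_block g (z : KP R L) : kp_deg R L g z ->
  exists m n, natz m - natz n = g /\ kp_block m n z.
Proof.
move: z; apply: lspan_rect => [|a y z|_ [x [y [<- ->]]]].
- exists (map_mx intpos g), (map_mx intpos (- g)); rewrite zposK.
  by split=> //; apply: lspan0.
- move=> [m [n [mn my]]] [m' [n' [mn' mz]]].
  have e : n + m' = m + n'.
    apply/natz_inj/eqP; rewrite !natzD -subr_eq -addrA mn' -mn.
    by rewrite addrC subrK.
  exists (m + m'), (n + m'); split.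
    by rewrite !natzD opprD addrACA subrr addr0.
  apply: lspanP; first exact: kp_block_refine.
  by rewrite e [m + m']addrC [m + n']addrC; apply: kp_block_refine.
- by exists (kg_d x), (kg_d y); split=> //; apply: kp_s_ss_block.
Qed.

(** Only the middle part s_b^* s_c of a product s_a s_b^* s_c s_d^* has to be
    rewritten, and kp_ss_s_block does so without changing its degree. *)
Lemma kp_degM g h (y z : KP R L) :
  kp_deg R L g y -> kp_deg R L h z -> kp_deg R L (g + h) (y ** z).
Proof.
have mid a d m n (w : KP R L) : kp_block m n w ->
    kp_deg R L (natz (kg_d a + m) - natz (kg_d d + n)) (s a ** w ** t d).
  move=> mw; apply: (lspan_map (F := rmul (t d) \o lmul (s a))) mw.
  move=> _ [[b c] /= [[_ <- <-] ->]]; rewrite numulA -numulA.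
  have [ab|/eqP ab] := eqVneq (kg_s a) (kg_r b); last first.
    by rewrite kp_s_s0 // numul0l; apply: lspan0.
  have [cd|/eqP cd] := eqVneq (kg_s d) (kg_r c); last first.
    by rewrite kp_ss_ss0 // numul0r; apply: lspan0.
  apply: lspan_mem; exists (kg_comp a b), (kg_comp d c).
  by rewrite !kg_d_comp // kp_sM // kp_ssM.
move=> gy hz; apply: (lspan_map (F := rmul z)) gy => _ [a [b [<- ->]]] /=.
apply: (lspan_map (F := lmul _)) hz => _ [c [d [<- ->]]] /=.
have := mid a d _ _ _ (kp_ss_s_block b c); rewrite !numulA.
rewrite !natzD [natz (kg_d d) + _]addrC opprD.
by rewrite [X in kp_deg R L X _]addrACA.
Qed.

(* The condition True fits the shape of the hypothesis of lspan_uniq. *)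
Lemma kp_span z : lspan (fun z => exists q : kg_mor L * kg_mor L,
  True /\ z = s q.1 ** t q.2) z.
Proof.
elim/pres_ind: z; elim=> [[v|x|x]|||||].
- apply: lspan_mem; exists (kg_id v, kg_id v).
  by rewrite kp_s_id kp_ss_id kp_pp.
- apply: lspan_mem; exists (x, kg_id (kg_s x)).
  by rewrite kp_ss_id kp_sp.
- apply: lspan_mem; exists (kg_id (kg_s x), x).
  by rewrite kp_s_id kp_pss.
- exact: lspan0.
- by move=> a IH; rewrite pres_piN -scaleN1r; apply: lspanZ.
- by move=> a IHa b IHb; rewrite pres_piD; apply: lspanD.
- by move=> c a IH; rewrite pres_piZ; apply: lspanZ.
move=> a + b IHb; rewrite pres_piM; move: (pres_pi _ a) => {}a.
apply: (lspan_map (F := rmul _)) => _ [[x y] /= [_ ->]].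
move: (pres_pi _ b) IHb => {}b.
apply: (lspan_map (F := lmul _)) => _ [[x' y'] /= [_ ->]].
have hom u u' : kp_deg R L (natz (kg_d u) - natz (kg_d u')) (s u ** t u').
  by apply: lspan_mem; exists u, u'.
apply: lspan_sub (kp_degM (hom x y) (hom x' y')) => _ [u [u' [_ ->]]].
by apply: lspan_mem; exists (u, u').
Qed.

End Relations.

(** * Homomorphisms twisted by a cocycle *)

Section Twist.
Variables (R : comPzRingType) (H : zmodType) (k l : nat).
Variables (L : kgraph k) (M : kgraph l) (e : 'rV[nat]_k -> 'rV[nat]_l).
Variables (o : kg_obj L -> kg_obj M) (m : kg_mor L -> kg_mor M).
Variable c : kg_mor L -> H.
Hypothesis o_inj : injective o.
Hypothesis m_r : forall x, kg_r (m x) = o (kg_r x).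
Hypothesis m_s : forall x, kg_s (m x) = o (kg_s x).
Hypothesis m_id : forall v, m (kg_id v) = kg_id (o v).
Hypothesis m_comp : forall x y, kg_s x = kg_r y ->
  m (kg_comp x y) = kg_comp (m x) (m y).
Hypothesis m_d : forall x, kg_d (m x) = e (kg_d x).
Hypothesis m_inj : forall x y, kg_d x = kg_d y -> m x = m y -> x = y.
Hypothesis m_lift : forall v n y, kg_r y = o v -> kg_d y = e n ->
  exists x, [/\ kg_r x = v, kg_d x = n & m x = y].
Hypothesis c_id : forall v, c (kg_id v) = 0.
Hypothesis c_comp : forall x y, kg_s x = kg_r y -> c (kg_comp x y) = c x + c y.

Variables (C : nuAlgType R) (X : group_extension (KP R M) H C).
Local Notation "x @^ h" := (ge_tens X h x) (at level 10).

Definition twist_spec (T : {linear KP R L -> C}) :=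
  [/\ forall v, T (kp_p R v) = (kp_p R (o v)) @^ 0,
      forall x, T (kp_s R x) = (kp_s R (m x)) @^ (c x)
    & forall x, T (kp_ss R x) = (kp_ss R (m x)) @^ (- c x)].

(** The hypotheses on (o, m) are those of a covering of k-graphs along a change
    of degrees e. The images of the generators satisfy the defining relations:
    (KP3) needs m to be injective in each degree and (KP4) needs it to lift
    paths; the twists cancel in s_x s_x^* and in s_x^* s_x. *)
Lemma kp_twist : exists T : {linear KP R L -> C},
  [/\ alg_hom T, twist_spec T & forall T' : {linear KP R L -> C},
      alg_hom T' -> twist_spec T' -> T' =1 T].
Proof.
pose phi (g : kp_gen L) : C := match g with
  | GenP v => (kp_p R (o v)) @^ 0
  | GenS x => (kp_s R (m x)) @^ (c x)
  | GenSs x => (kp_ss R (m x)) @^ (- c x)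
  end.
have rel : forall a b, kp_rel a b -> term_eval phi a = term_eval phi b.
  move=> a b; case=> {a b} /= [v|v|v|v w vw|x y xy|x y xy|x|x|x|x|x|x y dxy xy|v n E n0 uE EP].
  - by rewrite m_id kp_s_id c_id.
  - by rewrite m_id kp_ss_id c_id oppr0.
  - by rewrite ge_tensM kp_pp addr0.
  - by rewrite ge_tensM kp_pp0 ?linear0 // => /o_inj.
  - by rewrite ge_tensM kp_sM ?m_s ?m_r ?xy // m_comp // c_comp.
  - by rewrite ge_tensM kp_ssM ?m_s ?m_r ?xy // m_comp // c_comp // opprD addrC.
  - by rewrite ge_tensM -m_r kp_ps add0r.
  - by rewrite ge_tensM -m_s kp_sp addr0.
  - by rewrite ge_tensM -m_s kp_pss add0r.
  - by rewrite ge_tensM -m_r kp_ssp addr0.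
  - by rewrite ge_tensM kp_sss addNr m_s.
  - rewrite ge_tensM kp_sss0 ?linear0 // ?m_d ?dxy // => mxy.
    exact/xy/m_inj.
  have umE : uniq [seq m x | x <- E].
    rewrite map_inj_in_uniq // => x y /EP[_ dx] /EP[_ dy].
    by apply: m_inj; rewrite dx dy.
  have mEP y : y \in [seq m x | x <- E] <-> kg_r y = o v /\ kg_d y = e n.
    split=> [/mapP[x /EP[<- <-] ->]|[ry dy]]; first by rewrite m_r m_d.
    by have [x [rx dx <-]] := m_lift ry dy; apply/map_f/EP.
  rewrite (kp_psum R umE mEP) big_map linear_sum.
  elim: (E) => [|x E' IH]; first by rewrite big_nil.
  by rewrite big_cons /= -IH ge_tensM subrr.
have [F [Fm Fg Fu]] := pres_universal rel.
exists F; split; first exact: Fm.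
  by split=> [v|x|x]; [apply: (Fg (GenP v))|apply: (Fg (GenS x))|apply: (Fg (GenSs x))].
move=> T' T'm [Tp Ts Tss].
apply: (Fu T' T'm) => -[v|x|x].
- exact: Tp.
- exact: Ts.
- exact: Tss.
Qed.

End Twist.

(** * The grading of a Kumjian-Pask algebra and graded uniqueness *)

(** The last clause of is_grading, stated for a family in any module. *)
Definition deg_independent (R : comPzRingType) (G : zmodType) (V : lmodType R)
    (D : G -> V -> Prop) := forall (gs : seq G) (y : G -> V), uniq gs ->
  (forall g, D g (y g)) -> \sum_(g <- gs) y g = 0 -> forall g, g \in gs -> y g = 0.

Lemma sum_fibres (V : nmodType) (I J : eqType) (s : seq I) (d : I -> J) (F : I -> V) :
  \sum_(i <- s) F i = \sum_(j <- undup (map d s)) \sum_(i <- s | d i == j) F i.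
Proof.
rewrite (exchange_big_dep predT) //= !big_seq; apply: eq_bigr => i is_.
rewrite (eq_bigl (pred1 (d i))); last by move=> j /=; rewrite eq_sym.
by rewrite -big_filter filter_pred1_uniq ?undup_uniq ?mem_undup ?map_f ?big_seq1.
Qed.

Section Grading.
Variables (R : comNzRingType) (k : nat) (L : kgraph k).
Hypothesis Lfin : row_finite L.
Local Notation p v := (kp_p R v).
Local Notation s x := (kp_s R x).
Local Notation t x := (kp_ss R x).

Lemma kp_decompose (z : KP R L) : exists (gs : seq 'rV[int]_k) (y : 'rV[int]_k -> KP R L),
  [/\ uniq gs, forall g, kp_deg R L g (y g) & z = \sum_(g <- gs) y g].
Proof.
have [Q [c [_ _ ->]]] := lspan_uniq (kp_span Lfin z).
pose d (q : kg_mor L * kg_mor L) := natz (kg_d q.1) - natz (kg_d q.2).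
exists (undup (map d Q)).
exists (fun g => \sum_(q <- Q | d q == g) c q *: (s q.1 ** t q.2)).
split; [exact: undup_uniq| |exact: sum_fibres].
move=> g; rewrite -big_filter; apply: lspan_sum => q.
rewrite mem_filter => /andP[/eqP <- _]; apply/lspanZ/lspan_mem.
by exists q.1, q.2.
Qed.

(** The coaction z |-> z (x) u_g for z of degree g is a homomorphism defined on
    generators; it reads off the homogeneous components of an element. *)
Lemma kp_coaction (C : nuAlgType R) (X : group_extension (KP R L) 'rV[int]_k C) :
  exists T : {linear KP R L -> C},
    forall g z, kp_deg R L g z -> T z = ge_tens X g z.
Proof.
have [|||||||||x y xy|T [Tm [_ Ts Tss] _]] := @kp_twist R 'rV[int]_k k k L L id id id
  (fun x => natz (kg_d x)) _ _ _ _ _ _ _ _ _ _ _ X => //.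
- by move=> v n y; exists y.
- by move=> v; rewrite kg_d_id natz0.
- by rewrite kg_d_comp // natzD.
exists T => g z; move: z; apply: lspan_rect => [|a y z Ty Tz|_ [x [y [<- ->]]]].
- by rewrite !linear0.
- by rewrite !linearP Ty Tz.
- by rewrite Tm Ts Tss ge_tensM.
Qed.

Lemma kp_deg_independent : deg_independent (kp_deg R L).
Proof.
move=> gs y ugs yD y0 g ing.
have [C X] : {C & group_extension (KP R L) 'rV[int]_k C}.
  by exists (tensor (KP R L) (galg R 'rV[int]_k)); apply: tensor_extension.
have [T Tdeg] := kp_coaction X.
have : ge_coef X g (T (\sum_(h <- gs) y h)) = 0 by rewrite y0 !linear0.
rewrite !linear_sum (bigD1_seq g) //= (Tdeg _ _ (yD g)) ge_coef_tens eqxx.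
rewrite big1 ?addr0 // => h /negPf hg.
by rewrite (Tdeg _ _ (yD h)) ge_coef_tens hg.
Qed.

Lemma kp_grading : is_grading (kp_deg R L).
Proof.
split=> [g|g h y z|z|].
- by split=> [|a y z]; [exact: lspan0|exact: lspanP].
- exact: kp_degM.
- by have [gs [y [_ yD zE]]] := kp_decompose z; exists gs, y.
- exact: kp_deg_independent.
Qed.

(** Inside one block, multiplying by s_x^* and s_y isolates the coefficient of
    s_x s_y^*, as a multiple of a vertex idempotent. *)
Lemma kp_block_coef (Q : seq (kg_mor L * kg_mor L)) (c : kg_mor L * kg_mor L -> R)
    m n x y : uniq Q ->
    (forall q, q \in Q -> [/\ kg_s q.1 = kg_s q.2, kg_d q.1 = m & kg_d q.2 = n]) ->
    (x, y) \in Q ->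
  t x ** (\sum_(q <- Q) c q *: (s q.1 ** t q.2)) ** s y = c (x, y) *: p (kg_s x).
Proof.
move=> uQ QP xyQ; have [/= xy dx dy] := QP _ xyQ.
rewrite numul_sumr numul_suml (bigD1_seq (x, y)) //= big_seq_cond big1 ?addr0.
  by rewrite numulZr numulZl numulA kp_sss xy -numulA kp_sss kp_pp.
case=> a b /= /andP[/QP[/= ab da db]]; rewrite xpair_eqE negb_and => ne.
rewrite numulZr numulZl numulA -numulA.
case/orP: ne => /eqP ne.
- by rewrite kp_sss0 ?numul0l ?scaler0 ?dx // => /esym.
- by rewrite (kp_sss0 R _ ne) ?numul0r ?scaler0 ?db.
Qed.

(** The graded uniqueness theorem. Homogeneous components of a kernel element
    lie in the kernel, and each of them lies in one block, where T, not killing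
    any vertex idempotent, kills no coefficient. *)
Lemma graded_uniqueness (C : nuAlgType R) (E : 'rV[int]_k -> C -> Prop)
    (T : {linear KP R L -> C}) : alg_hom T -> deg_independent E ->
    (forall g z, kp_deg R L g z -> E g (T z)) ->
    (forall v a, a *: T (p v) = 0 -> a = 0) ->
  injective T.
Proof.
move=> Tm Eind TE Tp; apply: raddf_inj => z Tz.
have [gs [y [ugs yD zE]]] := kp_decompose z.
rewrite zE big_seq big1 // => g ing.
have : T (y g) = 0.
  apply: (Eind gs (T \o y)) => // [h|]; first exact/TE.
  by rewrite -linear_sum -zE.
have [m [n [_ /lspan_uniq [Q [c [uQ QP ->]]]]]] := kp_deg_block Lfin (yD g).
set w := \sum_(q <- Q) _ => Tw; rewrite /w big_seq big1 // => -[a b] abQ.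
rewrite (Tp (kg_s a) (c (a, b))) ?scale0r // -linearZ.
by rewrite -(kp_block_coef c uQ QP abQ) !Tm Tw numul0r numul0l.
Qed.

End Grading.

(** * Vertex idempotents do not vanish *)

Section Germs.
Variables (R : comNzRingType) (k : nat) (L : kgraph k).
Implicit Types (x y z w : kg_mor L) (g h : kg_mor L -> R).

Lemma kg_degI (m n n' : 'rV[nat]_k) : m + n = m + n' -> n = n'.
Proof. by move/(congr1 (@Defs.natz k)); rewrite !natzD => /addrI /natz_inj. Qed.

Definition kg_cut x z : option (kg_mor L) :=
  if pselect (exists w, kg_s x = kg_r w /\ z = kg_comp x w) is left ex
  then Some (sval (cid ex)) else None.

Variant kg_cut_spec x z : option (kg_mor L) -> Prop :=
| KgCut w of kg_s x = kg_r w & z = kg_comp x w : kg_cut_spec x z (Some w)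
| KgNoCut of (forall w, kg_s x = kg_r w -> z <> kg_comp x w) : kg_cut_spec x z None.

Lemma kg_cutP x z : kg_cut_spec x z (kg_cut x z).
Proof.
rewrite /kg_cut; case: pselect => [ex|nex]; last first.
  by constructor=> w xw zE; apply: nex; exists w.
by case: cid => w /= [xw zE]; constructor.
Qed.

Lemma kg_cut_comp x w : kg_s x = kg_r w -> kg_cut x (kg_comp x w) = Some w.
Proof.
move=> xw; case: kg_cutP => [w' xw' e|/(_ w xw)//]; congr Some.
have dw : kg_d w = kg_d w'.
  by apply: (@kg_degI (kg_d x)); rewrite -!kg_d_comp // e.
by have [] := kg_cancel xw xw' erefl dw e.
Qed.

(** On indicator functions of paths this is concatenation, s_x sending that of
    w to that of xw, and s_x^* removes the prefix x. *)
Definition gen_act (q : kp_gen L) g z : R := match q with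
  | GenP v => if kg_r z == v then g z else 0
  | GenS x => if kg_cut x z is Some w then g w else 0
  | GenSs x => if kg_s x == kg_r z then g (kg_comp x z) else 0
  end.

Fixpoint term_act (u : aterm R (kp_gen L)) g z : R := match u with
  | TGen q => gen_act q g z
  | TZero => 0
  | TOpp u => - term_act u g z
  | TAdd u u' => term_act u g z + term_act u' g z
  | TScale a u => a * term_act u g z
  | TMul u u' => term_act u (term_act u' g) z
  end.

Lemma term_actD u g h :
  term_act u (fun z => g z + h z) = fun z => term_act u g z + term_act u h z.
Proof.
elim: u g h => [q||u IH|u IHu u' IHu'|a u IH|u IHu u' IHu'] g h;
  rewrite funeqE => z /=.
- case: q => [v|x|x] /=; try by case: ifP; rewrite ?addr0.
  by case: (kg_cut x z) => [w|]; rewrite ?addr0.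
- by rewrite addr0.
- by rewrite IH opprD.
- by rewrite IHu IHu' addrACA.
- by rewrite IH mulrDr.
- by rewrite IHu' IHu.
Qed.

Lemma term_actZ u a g :
  term_act u (fun z => a * g z) = fun z => a * term_act u g z.
Proof.
elim: u g => [q||u IH|u IHu u' IHu'|b u IH|u IHu u' IHu'] g;
  rewrite funeqE => z /=.
- case: q => [v|x|x] /=; try by case: ifP; rewrite ?mulr0.
  by case: (kg_cut x z) => [w|]; rewrite ?mulr0.
- by rewrite mulr0.
- by rewrite IH mulrN.
- by rewrite IHu IHu' mulrDr.
- by rewrite IH mulrCA.
- by rewrite IHu' IHu.
Qed.

(** Only up to this relation does the action satisfy (KP4): a path whose degree
    is not at least n has no prefix of degree n. *)
Definition tail_eq g h :=
  exists N, forall z n, kg_d z = N + n -> g z = h z.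

Lemma tail_eq_refl g : tail_eq g g.
Proof. by exists 0. Qed.
Lemma tail_eq_fun g h : g =1 h -> tail_eq g h.
Proof. by exists 0. Qed.
Lemma tail_eq_sym g h : tail_eq g h -> tail_eq h g.
Proof. by move=> [N gh]; exists N => z n dz; rewrite (gh z n). Qed.
Lemma tail_eq_map2 (F : R -> R -> R) g g' h h' : tail_eq g g' -> tail_eq h h' ->
  tail_eq (fun z => F (g z) (h z)) (fun z => F (g' z) (h' z)).
Proof.
move=> [M gM] [N hN]; exists (M + N) => z n dz.
by rewrite (gM z (N + n)) ?(hN z (M + n)) // dz ?addrA // [N + M]addrC.
Qed.
Lemma tail_eq_trans g h g' : tail_eq g h -> tail_eq h g' -> tail_eq g g'.
Proof.
move=> [M gM] [N hN]; exists (M + N) => z n dz.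
by rewrite (gM z (N + n)) ?(hN z (M + n)) // dz ?addrA // [N + M]addrC.
Qed.

Lemma term_act_tail u g h : tail_eq g h -> tail_eq (term_act u g) (term_act u h).
Proof.
elim: u g h => [q||u IH|u IHu u' IHu'|a u IH|u IHu u' IHu'] g h gh /=.
- case: gh => N gh; case: q => [v|x|x].
  + by exists N => z n dz /=; rewrite (gh z n).
  + exists (kg_d x + N) => z n dz /=; case: kg_cutP => // w xw zE.
    apply: (gh w n); apply: (@kg_degI (kg_d x)).
    by rewrite -kg_d_comp // -zE dz addrA.
  + exists N => z n dz /=; case: eqP => // xz.
    by apply: (gh _ (kg_d x + n)); rewrite kg_d_comp // dz addrCA.
- exact: tail_eq_refl.
- exact: (tail_eq_map2 (fun a _ => - a) (IH _ _ gh) (IH _ _ gh)).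
- exact: (tail_eq_map2 +%R (IHu _ _ gh) (IHu' _ _ gh)).
- exact: (tail_eq_map2 (fun b _ => a * b) (IH _ _ gh) (IH _ _ gh)).
- by apply: IHu; apply: IHu'.
Qed.

Lemma term_act_rel u u' g : kp_rel u u' -> tail_eq (term_act u g) (term_act u' g).
Proof.
case=> {u u'} /=.
- move=> v; apply: tail_eq_fun => z /=; case: kg_cutP => [w|no].
    by rewrite kg_s_id => -> ->; rewrite kg_comp1m eqxx.
  case: eqP => // zv; case: (no z); first by rewrite kg_s_id.
  by rewrite -zv kg_comp1m.
- move=> v; apply: tail_eq_fun => z /=; rewrite kg_s_id eq_sym.
  by case: eqP => // <-; rewrite kg_comp1m.
- by move=> v; apply: tail_eq_fun => z /=; case: eqP.
- move=> v w vw; apply: tail_eq_fun => z /=; case: eqP => // ->.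
  by case: eqP => // /vw.
- move=> x y xy; apply: tail_eq_fun => z /=.
  case: kg_cutP => [w xw ->|no]; last first.
    case: kg_cutP => // w; rewrite kg_s_comp // => yw zE.
    case: (no (kg_comp y w)); first by rewrite kg_r_comp.
    by rewrite kg_compA.
  case: kg_cutP => [w' yw' wE|no].
    by rewrite wE kg_compA // kg_cut_comp // kg_s_comp.
  case: kg_cutP => // w'; rewrite kg_s_comp // => yw' zE.
  case: (no w') => //; have e : kg_s x = kg_r (kg_comp y w') by rewrite kg_r_comp.
  suff [] : Some w = Some (kg_comp y w') by [].
  by rewrite -(kg_cut_comp xw) zE -kg_compA // (kg_cut_comp e).
- move=> x y xy; apply: tail_eq_fun => z /=; rewrite kg_s_comp //.
  case: eqP => // yz; rewrite kg_r_comp // xy eqxx.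
  by rewrite kg_compA.
- move=> x; apply: tail_eq_fun => z /=; case: eqP => // zx.
  by case: kg_cutP => // w xw zE; case: zx; rewrite zE kg_r_comp.
- by move=> x; apply: tail_eq_fun => z /=; case: kg_cutP => // w <-; rewrite eqxx.
- move=> x; apply: tail_eq_fun => z /=; rewrite [kg_r z == _]eq_sym.
  by case: eqP.
- move=> x; apply: tail_eq_fun => z /=; case: eqP => // xz.
  by rewrite kg_r_comp // eqxx.
- move=> x; apply: tail_eq_fun => z /=; rewrite [kg_r z == _]eq_sym.
  by case: eqP => // xz; rewrite kg_cut_comp.
- move=> x y dxy xy; apply: tail_eq_fun => z /=; case: eqP => // xz.
  case: kg_cutP => // w yw e; case: xy.
  have dz : kg_d z = kg_d w.
    by apply: (@kg_degI (kg_d x)); rewrite {2}dxy -!kg_d_comp // e.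
  by have [] := kg_cancel xz yw dxy dz e.
move=> v n E n0 uE EP; exists n => z m dz /=.
have -> : term_act (tsum [seq TMul (TGen R (GenS x)) (TGen R (GenSs x)) | x <- E]) g z
    = \sum_(x <- E) (if kg_cut x z is Some _ then g z else 0).
  elim: (E) => [|x E' IH] /=; first by rewrite big_nil.
  rewrite big_cons IH; congr (_ + _); case: kg_cutP => // w xw ->.
  by rewrite xw eqxx.
have [a [w [aw zE da dw]]] := kg_fact dz.
case: eqP => rz; last first.
  rewrite big_seq big1 // => x /EP[rx dx]; case: kg_cutP => // b xb zE'.
  by case: rz; rewrite zE' kg_r_comp.
have aE : a \in E by apply/EP; rewrite -rz zE kg_r_comp.
rewrite (bigD1_seq a) //=; have -> : kg_cut a z = Some w by rewrite zE kg_cut_comp.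
rewrite big_seq_cond big1 ?addr0 //.
move=> x /andP[/EP[rx dx] xa]; case: kg_cutP => // b xb zE'.
have dab : kg_d b = kg_d w.
  by apply: (@kg_degI (kg_d x)); rewrite -kg_d_comp // -zE' zE kg_d_comp // dx da.
have [xa' _] : x = a /\ b = w.
  by apply: kg_cancel => //; rewrite ?dx ?da // -zE' zE.
by rewrite xa' eqxx in xa.
Qed.

Lemma term_act_cong u u' g :
  acong (@kp_rel R k L) u u' -> tail_eq (term_act u g) (term_act u' g).
Proof.
move=> uu'; elim: uu' g => {u u'} /=; try by move=> *; apply: tail_eq_fun => ? /=;
  rewrite ?(addrA, add0r, addNr, mulrA, mul1r, mulrDr, mulrDl, term_actD, term_actZ).
- by move=> u u' /term_act_rel.
- by move=> u u' _ IH g; apply/tail_eq_sym.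
- by move=> u u' u'' _ IH _ IH' g; apply: tail_eq_trans (IH g) (IH' g).
- by move=> u u' _ IH g; apply: (tail_eq_map2 (fun a _ => - a) (IH g) (IH g)).
- by move=> u u' w w' _ IH _ IH' g; apply: (tail_eq_map2 +%R (IH g) (IH' g)).
- by move=> a u u' _ IH g; apply: (tail_eq_map2 (fun b _ => a * b) (IH g) (IH g)).
- move=> u u' w w' _ IH _ IH' g.
  exact: tail_eq_trans (term_act_tail u (IH' g)) (IH _).
- by move=> u u' g; apply: tail_eq_fun => z /=; rewrite addrC.
Qed.

(** If a p_v = 0, then a p_v kills the constant function 1 on long paths, and
    some long path has range v. *)
Lemma kp_p_torsionfree (Lnos : no_sources L) (v : kg_obj L) (a : R) :
  a *: kp_p R v = 0 -> a = 0.
Proof.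
move=> av; have : acong (@kp_rel R k L) (TScale a (TGen R (GenP v))) TZero.
  by apply/pres_piP; rewrite pres_piZ.
case/(term_act_cong (fun=> 1)) => N aN.
have [z [zv dz]] := Lnos v N.
by have := aN z 0; rewrite addr0 /= zv eqxx mulr1; apply.
Qed.

End Germs.

(** * The isomorphism for a pullback *)

Lemma is_grading_transport (R : comPzRingType) (G : zmodType) (A B : nuAlgType R)
    (D : G -> A -> Prop) (E : G -> B -> Prop) (F : {linear A -> B}) :
    is_grading D -> alg_hom F -> bijective F ->
    (forall g x, D g x <-> E g (F x)) ->
  is_grading E.
Proof.
move=> [Dlin DM Dsum Dind] FM [F' FK F'K] DE.
have ED g z : E g z -> D g (F' z) by rewrite DE F'K.
split=> [g|g h x y xE yE|z|gs y ugs yE y0 g ing].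
- split=> [|a x y /ED xD /ED yD]; first by rewrite -(linear0 F) -DE; case: (Dlin g).
  rewrite -(F'K x) -(F'K y) -linearP -DE; case: (Dlin g) => _; exact.
- by rewrite -(F'K x) -(F'K y) -FM -DE; apply: DM; apply: ED.
- have [gs [y [yD zE]]] := Dsum (F' z); exists gs, (F \o y).
  split=> [g|]; first exact/DE.
  by rewrite -(F'K z) zE linear_sum.
- suff yg : F' (y g) = 0 by rewrite -(F'K (y g)) yg linear0.
  apply: (Dind gs (F' \o y) ugs) => // [h|]; first exact/ED.
  apply: (can_inj FK); rewrite linear0 linear_sum -[RHS]y0.
  by apply: eq_bigr => h _ /=; rewrite F'K.
Qed.

Section PullbackIso.
Variables (R : comNzRingType) (k l : nat) (G : kgraph l).
Hypotheses (Gfin : row_finite G) (Gnos : no_sources G).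
Variable f : {additive 'rV[nat]_k -> 'rV[nat]_l}.
Hypothesis fsurj : forall m, exists n, f n = m.
Variable j : {additive 'rV[int]_l -> 'rV[int]_k}.
Hypothesis jK : cancel j (gcompl f).
Local Notation L := (pullback f G).
Local Notation deg g := (hdeg jK g).
Local Notation hp x := (hpath (G := G) jK x).

Lemma pb_lift n (y : kg_mor G) : kg_d y = f n ->
  exists x : kg_mor L, pb_path x = y /\ kg_d x = n.
Proof. by move/eqP=> dy; exists (exist _ (y, n) dy). Qed.

Lemma pullback_row_finite : row_finite L.
Proof.
move=> v n; have [s inE] := Gfin v (f n).
exists (pmap (fun y => insub (y, n)) s) => x rx dx.
rewrite mem_pmap; apply/mapP; exists (pb_path x).
  by apply: inE => //; rewrite pb_pathP -dx.
have -> : (pb_path x, n) = val x by rewrite -dx [RHS]surjective_pairing.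
by rewrite valK.
Qed.

(** With the two lemmas below, Z^k is Z^l x H by means of gcompl f and hdeg. *)
Lemma deg_split g : g = j (gcompl f g) + val (deg g).
Proof. by rewrite addrC subrK. Qed.

Lemma gcompl_split q (h : Hker f) : gcompl f (j q + val h) = q.
Proof.
have := valP h; rewrite unfold_in => /eqP hK.
by rewrite raddfD /= jK hK addr0.
Qed.

Lemma deg_split_ker q (h : Hker f) : deg (j q + val h) = h.
Proof. by apply: val_inj; rewrite /= gcompl_split addrC addKr. Qed.

Lemma hpath_comp (x y : kg_mor L) : kg_s x = kg_r y ->
  hp (kg_comp x y) = hp x + hp y.
Proof.
move=> xy; apply: val_inj => /=.
by rewrite pb_d_comp // pb_path_comp // kg_d_comp // !natzD raddfD opprD addrACA.
Qed.

Lemma hpath_id (v : kg_obj L) : hp (kg_id v) = 0.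
Proof.
apply: val_inj; rewrite /= /pb_d /pb_path /=.
by rewrite kg_d_id !natz0 raddf0 subr0.
Qed.

Lemma deg_path (x y : kg_mor L) :
  gcompl f (natz (kg_d x) - natz (kg_d y)) =
    natz (kg_d (pb_path x)) - natz (kg_d (pb_path y)) /\
  deg (natz (kg_d x) - natz (kg_d y)) = hp x - hp y.
Proof.
have e : gcompl f (natz (kg_d x) - natz (kg_d y)) =
    natz (kg_d (pb_path x)) - natz (kg_d (pb_path y)).
  by rewrite gcomplB !pb_pathP.
split=> //; apply: val_inj => /=.
by rewrite e raddfB /= !opprD !opprK addrACA.
Qed.

Variables (C : nuAlgType R) (X : group_extension (KP R G) (Hker f) C).
Local Notation "x @^ h" := (ge_tens X h x) (at level 10).

Local Notation pb_spec T := (@twist_spec R (Hker f) k l L G (fun v => v)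
  (@pb_path k l f G) (fun x => hp x) C X T).

Definition ext_deg (g : 'rV[int]_k) (z : C) :=
  exists b, kp_deg R G (gcompl f g) b /\ z = b @^ (deg g).

(** The coefficient of u_h involves only the degrees g with component h in the
    kernel; on these gcompl f is injective, and independence in B applies. *)
Lemma ext_deg_independent : deg_independent ext_deg.
Proof.
move=> gs y ugs yE y0 g ing.
pose b h := ge_coef X (deg h) (y h).
have yb h : y h = b h @^ (deg h).
  by rewrite /b; have [c [_ ->]] := yE h; rewrite ge_coef_tens eqxx.
have bE h : kp_deg R G (gcompl f h) (b h).
  by rewrite /b; have [c [cE ->]] := yE h; rewrite ge_coef_tens eqxx.
pose hs := [seq h <- gs | deg h == deg g].
have hsE h : h \in hs -> j (gcompl f h) + val (deg g) = h.
  by rewrite mem_filter => /andP[/eqP <- _]; rewrite -deg_split.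
suff : b (j (gcompl f g) + val (deg g)) = 0.
  by rewrite -deg_split yb => ->; rewrite linear0.
apply: (kp_deg_independent (gs := map (gcompl f) hs)
  (y := fun q => b (j q + val (deg g)))).
- rewrite map_inj_in_uniq ?filter_uniq // => h h' /hsE <- /hsE <-.
  by rewrite !gcompl_split => ->.
- by move=> q; rewrite -[X in kp_deg R G X](gcompl_split q (deg g)).
- have bg0 : \sum_(h <- gs | deg h == deg g) b h = 0.
    rewrite -[RHS](linear0 (ge_coef X (deg g))) -y0 linear_sum big_mkcond /=.
    by apply: eq_bigr => h _; rewrite [in RHS]yb ge_coef_tens; case: eqP.
  rewrite big_map -[RHS]bg0 -[RHS]big_filter !big_seq.
  by apply: eq_bigr => h /hsE ->.
- by apply: map_f; rewrite mem_filter eqxx.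
Qed.

(** Properties of any homomorphism T given by the formulas for Theta. *)
Section Theta.
Variable T : {linear KP R L -> C}.
Hypotheses (TM : alg_hom T)
  (Tspec : pb_spec T).

Lemma T_unit (x y : kg_mor L) : T (kp_s R x ** kp_ss R y) =
  (kp_s R (pb_path x) ** kp_ss R (pb_path y)) @^ (deg (natz (kg_d x) - natz (kg_d y))).
Proof.
by have [_ Ts Tss] := Tspec; rewrite TM Ts Tss ge_tensM (deg_path x y).2.
Qed.

Lemma T_deg g z : kp_deg R L g z -> ext_deg g (T z).
Proof.
move: z; apply: lspan_rect => [|a y z [b [bE yE]] [c [cE zE]]|_ [x [y [<- ->]]]].
- by exists 0; rewrite !linear0; split=> //; apply: lspan0.
- exists (a *: b + c); rewrite !linearP yE zE; split=> //.
  exact: lspanP.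
- exists (kp_s R (pb_path x) ** kp_ss R (pb_path y)); rewrite T_unit; split=> //.
  apply: lspan_mem; exists (pb_path x), (pb_path y); split=> //.
  by rewrite (deg_path x y).1.
Qed.

(** For paths x and y of G, s_x s_y^* @^ h need not be the image of a product of
    two generators: that takes n and m in N^k with n - m = g, f(n) = d(x) and
    f(m) = d(y). Surjectivity of f provides such n and m once x and y have been
    extended by all paths of degree f(g^+). *)
Lemma T_deg_lift g z : ext_deg g z -> exists x, kp_deg R L g x /\ T x = z.
Proof.
move=> [b [/(kp_deg_block Gfin)[m [n [mn bmn]]] ->]].
have [t ft] := fsurj m.
pose gp : 'rV[nat]_k := map_mx intpos g; pose gm : 'rV[nat]_k := map_mx intpos (- g).
have gE : natz (gp + t) - natz (gm + t) = g.
  by rewrite !natzD opprD addrACA subrr addr0 zposK.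
have fgp : m + f gp = f (gp + t) by rewrite raddfD ft addrC.
have bmn' := kp_block_refine Gfin (f gp) bmn; rewrite fgp in bmn'.
have fgm : n + f gp = f (gm + t).
  apply/natz_inj; rewrite raddfD /= ft !natzD.
  have /eqP := mn; rewrite subr_eq => /eqP ->; rewrite -/gp -/gm.
  by rewrite addrA [_ + gcompl f g]addrC subrK addrC.
rewrite fgm in bmn'; move: b bmn' {bmn}; apply: lspan_rect => [|a b c|].
- by exists 0; rewrite !linear0; split=> //; apply: lspan0.
- move=> [x [xg Tx]] [y [yg Ty]]; exists (a *: x + y).
  by split; [exact: lspanP|rewrite !linearP Tx Ty].
move=> _ [[a b] /= [[ab /pb_lift [x [<- xd]] /pb_lift [y [<- yd]]] ->]].
exists (kp_s R x ** kp_ss R y); rewrite T_unit xd yd gE; split=> //.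
by apply: lspan_mem; exists x, y; rewrite xd yd gE.
Qed.

Lemma T_surj z : exists x, T x = z.
Proof.
move: z (ge_span X z); apply: lspan_rect => [|a _ _ [x <-] [y <-]|_ [h [b ->]]].
- by exists 0; rewrite linear0.
- by exists (a *: x + y); rewrite linearP.
move: b (kp_span Gfin b); apply: lspan_rect => [|a b c [x Tx] [y Ty]|].
- by exists 0; rewrite !linear0.
- by exists (a *: x + y); rewrite !linearP Tx Ty.
move=> _ [[a b] /= [_ ->]]; set q := natz (kg_d a) - natz (kg_d b).
have [|x [_ Tx]] := @T_deg_lift (j q + val h) ((kp_s R a ** kp_ss R b) @^ h).
  exists (kp_s R a ** kp_ss R b); rewrite gcompl_split deg_split_ker; split=> //.
  by apply: lspan_mem; exists a, b.
by exists x.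
Qed.

Lemma T_inj : injective T.
Proof.
apply: (graded_uniqueness pullback_row_finite TM ext_deg_independent T_deg).
move=> v a; have [-> _ _] := Tspec; rewrite -linearZ => /(congr1 (ge_coef X 0)).
rewrite ge_coef_tens eqxx linear0; exact: kp_p_torsionfree.
Qed.

Lemma T_graded_iso : graded_iso (kp_deg R L) ext_deg T.
Proof.
have Tbij : bijective T.
  exists (fun z => sval (cid (T_surj z))) => [x|z]; last by case: cid.
  by apply: T_inj; case: cid.
have Tdeg g z : kp_deg R L g z <-> ext_deg g (T z).
  split; first exact: T_deg.
  by case/T_deg_lift => x [xg /T_inj <-].
have Dgr := kp_grading R pullback_row_finite.
by split=> //; apply: is_grading_transport Dgr TM Tbij Tdeg.
Qed.

End Theta.

Lemma kp_pullback_iso : exists T : {linear KP R L -> C},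
  [/\ pb_spec T,
      graded_iso (kp_deg R L) ext_deg T
    & forall T' : {linear KP R L -> C}, alg_hom T' ->
        pb_spec T' ->
        T' =1 T].
Proof.
have [||||||||||T [TM Ts Tu]] := @kp_twist R (Hker f) k l L G f (fun v => v)
  (@pb_path k l f G) (fun x => hp x) _ _ _ _ _ _ _ _ _ _ C X => //.
- exact: pb_path_comp.
- exact: pb_pathP.
- by move=> x y dxy pxy; apply: pb_ext.
- by move=> v n y ry /pb_lift [x [xy xd]]; exists x; rewrite -xy in ry *.
- exact: hpath_id.
- exact: hpath_comp.
by exists T; split=> //; apply: T_graded_iso.
Qed.

End PullbackIso.

(** * The tensor product with the group algebra of the kernel *)

(** Typed in theta_cod, so that the results for an arbitrary extension apply to
    the target of Theta as it stands. *)
Definition theta_extension (K : fieldType) (k l : nat) (G : kgraph l)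
    (f : {additive 'rV[nat]_k -> 'rV[nat]_l}) :
    group_extension (KP K G) (Hker f) (theta_cod K G f) :=
  tensor_extension (KP K G) (Hker f).

Lemma theta_degE (K : fieldType) (k l : nat) (G : kgraph l)
    (f : {additive 'rV[nat]_k -> 'rV[nat]_l})
    (j : {additive 'rV[int]_l -> 'rV[int]_k}) (jK : cancel j (gcompl f)) g z :
  theta_deg (G := G) jK g z <-> ext_deg jK (theta_extension K G f) g z.
Proof.
have := @tens_sub_gu K (KP K G) (Hker f) (kp_deg K G (gcompl f g)) (hdeg jK g) z.
apply; first exact: lspan0.
by move=> a x y; apply: lspanP.
Qed.

Lemma theta_extensionE (K : fieldType) (k l : nat) (G : kgraph l)
    (f : {additive 'rV[nat]_k -> 'rV[nat]_l}) h x :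
  ge_tens (theta_extension K G f) h x = x \ox gu K h.
Proof. reflexivity. Qed.

Lemma theta_specE (K : fieldType) (k l : nat) (G : kgraph l)
    (f : {additive 'rV[nat]_k -> 'rV[nat]_l})
    (j : {additive 'rV[int]_l -> 'rV[int]_k}) (jK : cancel j (gcompl f))
    (T : {linear KP K (pullback f G) -> theta_cod K G f}) :
  theta_spec jK T <-> @twist_spec K (Hker f) k l (pullback f G) G (fun v => v)
    (@pb_path k l f G) (fun x => hpath jK x) _ (theta_extension K G f) T.
Proof.
split=> -[Tp Ts Tss]; split.
- by move=> v; rewrite theta_extensionE; apply: Tp.
- by move=> x; rewrite theta_extensionE; apply: Ts.
- by move=> x; rewrite theta_extensionE; apply: Tss.
- by move=> v; have := Tp v; rewrite theta_extensionE.
- by move=> x; have := Ts x; rewrite theta_extensionE.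
- by move=> x; have := Tss x; rewrite theta_extensionE.
Qed.

Theorem theorem3p2 (K : fieldType) (k l : nat) (G : kgraph l)
    (Gfin : row_finite G) (Gnos : no_sources G)
    (f : {additive 'rV[nat]_k -> 'rV[nat]_l})
    (fsurj : forall m, exists n, f n = m)
    (j : {additive 'rV[int]_l -> 'rV[int]_k})
    (jK : cancel j (gcompl f)) :
  exists Theta : {linear KP K (pullback f G) -> theta_cod K G f},
    [/\ theta_spec jK Theta,
        graded_iso (kp_deg K (pullback f G)) (theta_deg (G := G) jK) Theta
      & forall Theta' : {linear KP K (pullback f G) -> theta_cod K G f},
          alg_hom Theta' -> theta_spec jK Theta' -> Theta' =1 Theta].
Proof.
have [T [Ts Tiso Tu]] := kp_pullback_iso Gfin Gnos fsurj jK
  (theta_extension K G f).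
exists T; split.
- exact/theta_specE.
- have -> // : theta_deg jK = ext_deg jK (theta_extension K G f).
  by apply/funext => g; apply/funext => z; apply/propext/theta_degE.
- by move=> T' T'M /theta_specE; apply: Tu.
Qed.
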